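(* Let $2<n<\omega$, let $\mathfrak A\in\mathbf S_c\mathsf{Nr}_n\mathsf{CA}_\omega$ be countable, let $\lambda<2^\omega$ be a cardinal and let $\mathbf X=(X_i:i<\lambda)$ be a family of non-principal types of $\mathfrak A$. Then: (1) If $\mathfrak A\in\mathsf{Nr}_n\mathsf{CA}_\omega$ and each $X_i$ is a maximal non-principal ultrafilter, then $\mathbf X$ can be omitted in a $\mathsf{Gs}_n$. (2) Every subfamily of $\mathbf X$ of cardinality $<\mathfrak p$ can be omitted in a $\mathsf{Gs}_n$; in particular every countable subfamily of $\mathbf X$ can be omitted in a $\mathsf{Gs}_n$. If moreover $\mathfrak A$ is simple, then every subfamily of $\mathbf X$ of cardinality $<\mathrm{cov}\,\mathsf K$ can be omitted in a $\mathsf{Cs}_n$. (3) If $\mathfrak A$ is atomic with countably many atoms, then any family of non-principal types of $\mathfrak A$ (in particular $\mathbf X$) can be omitted in an atomic $\mathsf{Gs}_n$; if $\mathfrak A$ is simple, $\mathsf{Gs}_n$ can be replaced by $\mathsf{Cs}_n$.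
   Context: $\mathsf{CA}_\alpha$: cylindric algebras of dimension $\alpha$. $\mathsf{Nr}_n\mathsf{CA}_\omega$: algebras isomorphic to the neat reduct $\mathfrak{Nr}_n\mathfrak B$ of some $\mathfrak B\in\mathsf{CA}_\omega$ (universe $\{x:c_ix=x\text{ for }n\le i<\omega\}$, operations with indices $<n$). $\mathfrak A\subseteq_c\mathfrak B$ means $\mathfrak A$ is a subalgebra of $\mathfrak B$ such that every $X\subseteq A$ with $\sum^{\mathfrak A}X=1$ satisfies $\sum^{\mathfrak B}X=1$; $\mathbf S_c$ is closure under (isomorphic copies of) such complete subalgebras. $\mathsf{Cs}_n$: cylindric set algebras with unit ${}^nU$; $\mathsf{Gs}_n$: generalized cylindric set algebras, whose unit is $V=\bigcup_{i\in I}{}^nU_i$ with the $U_i$ non-empty and pairwise disjoint and operations relativized to $V$. A non-principal type of $\mathfrak A$ is $X\subseteq A$ with $\prod X=0$. A family $(X_i)$ is omitted in $\mathfrak C\in\mathsf{Gs}_n$ if there is an isomorphism $f:\mathfrak A\to\mathfrak C$ with $\bigcap_{x\in X_i}f(x)=\emptyset$ for all $i$. $\mathfrak p$ is the pseudo-intersection number (least cardinality of a family of infinite subsets of $\omega$ with the strong finite intersection property and no infinite pseudo-intersection); $\mathrm{cov}\,\mathsf K$ is the covering number of the meager ideal (least number of meager sets covering the real line, equivalently ${}^\omega 2$). *)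

(* Defs.v *)
From mathcomp Require Export all_boot all_order all_algebra.
From mathcomp Require Export all_classical all_reals all_analysis.
Set Implicit Arguments.
Unset Strict Implicit.
Unset Printing Implicit Defensive.
Import Order.Theory.
Import numFieldNormedType.Exports.
Local Open Scope classical_set_scope.
Local Open Scope card_scope.

(** * Cylindric algebras *)

(* Boolean algebras are the library's complemented distributive lattices with
   top and bottom; the one-element algebra is allowed. The index type I plays
   the role of the dimension: 'I_n for dimension n and nat for dimension
   omega. *)
Record cylAlg (I : Type) := CylAlg {
  cyl_disp : Order.disp_t;
  cyl_car :> ctbDistrLatticeType cyl_disp;
  cyl : I -> cyl_car -> cyl_car;
  diag : I -> I -> cyl_car;
  cyl_bot : forall i, cyl i \bot%O = \bot%O;
  cyl_ext : forall i x, (x <= cyl i x)%O;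
  cyl_meet : forall i x y,
    cyl i (x `&` cyl i y)%O = (cyl i x `&` cyl i y)%O;
  cyl_comm : forall i j x, cyl i (cyl j x) = cyl j (cyl i x);
  diag_refl : forall i, diag i i = \top%O;
  diag_trans : forall i j k, k <> i -> k <> j ->
    diag i j = cyl k (diag i k `&` diag k j)%O;
  diag_cyl : forall i j x, i <> j ->
    (cyl i (diag i j `&` x) `&` cyl i (diag i j `&` ~` x))%O = \bot%O }.

Section Algebras.
Variable I : Type.
Implicit Types A B : cylAlg I.

Record cyl_hom A B (f : A -> B) : Prop := CylHom {
  hom_bot : f \bot%O = \bot%O;
  hom_top : f \top%O = \top%O;
  hom_join : forall x y, f (x `|` y)%O = (f x `|` f y)%O;
  hom_meet : forall x y, f (x `&` y)%O = (f x `&` f y)%O;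
  hom_compl : forall x, f (~` x)%O = (~` f x)%O;
  hom_cyl : forall i x, f (cyl i x) = cyl i (f x);
  hom_diag : forall i j, f (diag A i j) = diag B i j }.

Record subuniverse B (S : set B) : Prop := Subuniverse {
  sub_bot : S \bot%O;
  sub_top : S \top%O;
  sub_join : forall x y, S x -> S y -> S (x `|` y)%O;
  sub_meet : forall x y, S x -> S y -> S (x `&` y)%O;
  sub_compl : forall x, S x -> S (~` x)%O;
  sub_cyl : forall i x, S x -> S (cyl i x);
  sub_diag : forall i j, S (diag B i j) }.

(* A is isomorphic to the subalgebra of B with universe S. *)
Definition iso_to_sub A B (S : set B) : Prop :=
  subuniverse S /\
  exists f : A -> B, [/\ cyl_hom f, injective f & range f = S].

(* s is the sum of X computed in the subalgebra with universe S. *)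
Definition sum_in B (S X : set B) (s : B) : Prop :=
  [/\ S s, ubound X s & forall b, S b -> ubound X b -> (s <= b)%O].

Definition complete_subalgebra B (S : set B) : Prop :=
  subuniverse S /\
  forall X : set B, X `<=` S -> sum_in S X \top%O -> supremums X \top%O.

Record congruence A (E : A -> A -> Prop) : Prop := Congruence {
  cong_refl : forall x, E x x;
  cong_sym : forall x y, E x y -> E y x;
  cong_trans : forall x y z, E x y -> E y z -> E x z;
  cong_join : forall x x' y y', E x x' -> E y y' -> E (x `|` y)%O (x' `|` y')%O;
  cong_meet : forall x x' y y', E x x' -> E y y' -> E (x `&` y)%O (x' `&` y')%O;
  cong_compl : forall x x', E x x' -> E (~` x)%O (~` x')%O;
  cong_cyl : forall i x x', E x x' -> E (cyl i x) (cyl i x') }.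

Definition simple_alg A : Prop :=
  (exists x y : A, x <> y) /\
  forall E : A -> A -> Prop, congruence E ->
    (forall x y, E x y -> x = y) \/ (forall x y, E x y).

Definition is_atom A (a : A) : Prop :=
  a <> \bot%O /\ forall x : A, (x <= a)%O -> x = \bot%O \/ x = a.

Definition atomic_alg A : Prop :=
  forall x : A, x <> \bot%O -> exists2 a, is_atom a & (a <= x)%O.

Definition nonprincipal_type A (X : set A) : Prop := infimums X \bot%O.

Record proper_filter A (F : set A) : Prop := ProperFilter {
  filt_top : F \top%O;
  filt_bot : ~ F \bot%O;
  filt_meet : forall x y, F x -> F y -> F (x `&` y)%O;
  filt_up : forall x y, F x -> (x <= y)%O -> F y }.

Definition ultrafilter A (F : set A) : Prop :=
  proper_filter F /\
  forall G : set A, proper_filter G -> F `<=` G -> G = F.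

End Algebras.

(** * Neat reducts *)

(* The reduct keeps the cylindrifications and diagonals with index < n. *)
Definition reduct (n : nat) (B : cylAlg nat) : cylAlg 'I_n.
Proof.
refine (@CylAlg 'I_n _ (cyl_car B) (fun i => cyl (nat_of_ord i))
          (fun i j => diag B (nat_of_ord i) (nat_of_ord j)) _ _ _ _ _ _ _).
- by move=> i; exact: cyl_bot.
- by move=> i x; exact: cyl_ext.
- by move=> i x y; exact: cyl_meet.
- by move=> i j x; exact: cyl_comm.
- by move=> i; exact: diag_refl.
- by move=> i j k ki kj; apply: diag_trans => /val_inj.
- by move=> i j x ij; apply: diag_cyl => /val_inj.
Defined.

Definition neat (n : nat) (B : cylAlg nat) : set (reduct n B) :=
  [set x : B | forall i : nat, (n <= i)%N -> cyl i x = x].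
Arguments neat n B : clear implicits.

Definition NrCA (n : nat) (A : cylAlg 'I_n) : Prop :=
  exists B : cylAlg nat, iso_to_sub A (neat n B).

Definition ScNrCA (n : nat) (A : cylAlg 'I_n) : Prop :=
  exists2 C : cylAlg 'I_n, NrCA C &
    exists2 S : set C, complete_subalgebra S & iso_to_sub A S.

(** * Cylindric set algebras *)

Section SetAlgebras.
Variables (n : nat) (W : Type).
Implicit Types (V X Y : set ('I_n -> W)) (C : set (set ('I_n -> W))).

Definition set_cyl V (i : 'I_n) X : set ('I_n -> W) :=
  [set s | V s /\ exists2 t, X t & forall j, j <> i -> t j = s j].

Definition set_diag V (i j : 'I_n) : set ('I_n -> W) :=
  [set s | V s /\ s i = s j].

Record set_algebra V C : Prop := SetAlgebra {
  sa_sub : forall X, C X -> X `<=` V;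
  sa_empty : C set0;
  sa_unit : C V;
  sa_union : forall X Y, C X -> C Y -> C (X `|` Y);
  sa_inter : forall X Y, C X -> C Y -> C (X `&` Y);
  sa_compl : forall X, C X -> C (V `\` X);
  sa_cyl : forall i X, C X -> C (set_cyl V i X);
  sa_diag : forall i j, C (set_diag V i j) }.

Definition power (U : set W) : set ('I_n -> W) :=
  [set s | forall k, U (s k)].

Definition Cs V C : Prop :=
  set_algebra V C /\ exists U : set W, V = power U.

Definition Gs V C : Prop :=
  set_algebra V C /\
  exists (J : Type) (U : J -> set W),
    [/\ forall j, U j !=set0, trivIset setT U & V = \bigcup_j power (U j)].

Definition set_atom C (a : set ('I_n -> W)) : Prop :=
  [/\ C a, a !=set0 & forall X, C X -> X `<=` a -> X = set0 \/ X = a].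

Definition set_atomic C : Prop :=
  forall X, C X -> X !=set0 -> exists2 a, set_atom C a & a `<=` X.

Definition atomic_Cs V C : Prop := Cs V C /\ set_atomic C.
Definition atomic_Gs V C : Prop := Gs V C /\ set_atomic C.

(* f is an isomorphism from A onto the set algebra with unit V and
   universe C. *)
Record set_iso (A : cylAlg 'I_n) V C (f : A -> set ('I_n -> W)) : Prop :=
  SetIso {
  si_inj : injective f;
  si_range : range f = C;
  si_bot : f \bot%O = set0;
  si_top : f \top%O = V;
  si_join : forall x y, f (x `|` y)%O = f x `|` f y;
  si_meet : forall x y, f (x `&` y)%O = f x `&` f y;
  si_compl : forall x, f (~` x)%O = V `\` f x;
  si_cyl : forall i x, f (cyl i x) = set_cyl V i (f x);
  si_diag : forall i j, f (diag A i j) = set_diag V i j }.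

End SetAlgebras.

(* The subfamily of X indexed by S can be omitted in a set algebra of the
   class K. *)
Definition omitted (n : nat)
    (K : forall W : Type, set ('I_n -> W) -> set (set ('I_n -> W)) -> Prop)
    (A : cylAlg 'I_n) (L : Type) (S : set L) (X : L -> set A) : Prop :=
  exists (W : Type) (V : set ('I_n -> W)) (C : set (set ('I_n -> W)))
         (f : A -> set ('I_n -> W)),
    [/\ K W V C, set_iso V C f
      & forall i, S i -> \bigcap_(x in X i) f x = set0].

(** * Cardinals *)

Definition card_lt (T U : Type) (S : set T) (S' : set U) : Prop :=
  S #<= S' /\ ~ (S' #<= S).

(* |S| < min { |F| : P F }; as cardinals are well-ordered, this says that S
   is smaller than every F with P F. *)
Definition card_lt_min (T U : Type) (S : set T) (P : set (set U)) : Prop :=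
  forall F : set U, P F -> card_lt S F.

Definition sfip (F : set (set nat)) : Prop :=
  forall G : set (set nat), finite_set G -> G `<=` F ->
    infinite_set (\bigcap_(X in G) X).

Definition pseudo_intersection (F : set (set nat)) (P : set nat) : Prop :=
  forall X, F X -> finite_set (P `\` X).

Definition p_witness : set (set (set nat)) :=
  [set F | [/\ forall X, F X -> infinite_set X, sfip F &
    ~ exists2 P, infinite_set P & pseudo_intersection F P]].

Definition lt_p (T : Type) (S : set T) : Prop := card_lt_min S p_witness.

Definition nowhere_dense (T : topologicalType) (N : set T) : Prop :=
  interior (closure N) = set0.

Definition meager (T : topologicalType) (M : set T) : Prop :=
  exists2 N : nat -> set T, forall k, nowhere_dense (N k) & M = \bigcup_k N k.

Definition meager_cover (T : topologicalType) : set (set (set T)) :=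
  [set F | (forall M, F M -> meager M) /\ \bigcup_(M in F) M = setT].

Definition lt_covK (R : realType) (T : Type) (S : set T) : Prop :=
  card_lt_min S (@meager_cover R).

(* Main.v *)
Require Import Defs.
From mathcomp Require Import zify lra.
Set Implicit Arguments.
Unset Strict Implicit.
Unset Printing Implicit Defensive.
Import Order.Theory GRing.Theory Num.Theory.
Import numFieldNormedType.Exports.
Local Open Scope classical_set_scope.
Local Open Scope card_scope.

(** An algebra [A] in S_c Nr_n CA_omega sits in some [B] of dimension omega in such
    a way that no nonzero element of the neat reduct of [B] is a lower bound of a
    non-principal type of [A]. Read the dimensions [n, n+1, ...] of [B] as constants:
    for a tuple [s] of constants and [x] in [A], substitution gives an element
    [sb s x] of [B] saying that [s] satisfies [x]. The nonzero finite meets of such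
    elements form a countable forcing notion, and a descending sequence that meets
    countably many dense sets (deciding each [sb s x], and Henkin witnesses) is a
    set model with base the constants modulo equality. A non-principal type
    contributes, for each tuple, one more dense set to be met in order to omit it.
    Countably many dense sets are met by Rasiowa-Sikorski, fewer than p by a
    pseudo-intersection argument, fewer than cov K by coding descending sequences
    by reals. For ultrafilters one grows a perfect tree of models in which any
    given ultrafilter is realized at most once, so that one of the 2^omega branches
    omits them all. In the atomic case it is enough to omit the single type
    of the coatoms. Disjoint unions of the models give a Gs_n, and simplicity makes
    a single model faithful. *)

(** * Meeting dense sets *)

Section Forcing.
Variables (T : Type) (le : T -> T -> Prop).
Hypothesis le_refl : forall p, le p p.
Hypothesis le_trans : forall q p r, le p q -> le q r -> le p r.
Implicit Types (P D : set T) (p q r : T).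

Definition dense_open P D : Prop :=
  (forall p, P p -> exists q, [/\ P q, le q p & D q]) /\
  (forall p q, le q p -> D p -> D q).

Definition descending P p (s : nat -> T) : Prop :=
  [/\ s 0%N = p, forall j, P (s j) & forall j, le (s j.+1) (s j)].

Definition meets (s : nat -> T) D : Prop := exists j, D (s j).

(** The countably many sets [E] build the model; each family [D i] serves one type to be omitted,
    with one dense set per tuple. *)
Definition generic_for (L : Type) (S : set L) P : Prop :=
  forall (E : nat -> set T) (D : L -> nat -> set T),
    (forall k, dense_open P (E k)) ->
    (forall i, S i -> forall k, dense_open P (D i k)) ->
    forall p, P p -> exists s, [/\ descending P p s,
      forall k, meets s (E k) & forall i, S i -> forall k, meets s (D i k)].

Lemma dense_openT P : dense_open P setT.
Proof. by split=> // p Pp; exists p. Qed.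

Lemma descending_le P p s i j : descending P p s -> (i <= j)%N -> le (s j) (s i).
Proof.
case=> _ _ sD /subnK <-; elim: (j - i)%N => [|k IH]; first exact: le_refl.
by rewrite addSn; apply: le_trans IH; exact: sD.
Qed.

Lemma dense_open_finite P (K : eqType) (D : K -> set T) (ks : seq K) :
  {in ks, forall k, dense_open P (D k)} ->
  forall p, P p -> exists q, [/\ P q, le q p & {in ks, forall k, D k q}].
Proof.
elim: ks => [|k ks IH] dD p Pp; first by exists p; split.
have [k' k'ks|q [Pq qp Dq]] := IH _ p Pp; first by apply: dD; rewrite inE k'ks orbT.
have [/(_ q Pq) [r [Pr rq Dr]] _] := dD k (mem_head _ _).
exists r; split=> //; first exact: le_trans rq qp.
move=> k'; rewrite inE => /predU1P[->//|k'ks].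
have [_ /(_ q r rq)] : dense_open P (D k') by apply: dD; rewrite inE k'ks orbT.
by apply; exact: Dq.
Qed.

Lemma rasiowa_sikorski P (E : nat -> set T) :
  (forall k, dense_open P (E k)) -> forall p, P p ->
  exists2 s, descending P p s & forall k, meets s (E k).
Proof.
move=> dE p Pp.
have [f fP] : {f : nat * T -> T & forall kq, P kq.2 ->
    [/\ P (f kq), le (f kq) kq.2 & E kq.1 (f kq)]}.
  apply: (@choice _ _ (fun kq r => P kq.2 -> [/\ P r, le r kq.2 & E kq.1 r])).
  move=> [k q]; have [Pq|nPq] := pselect (P q); last by exists q.
  by have [/(_ q Pq)[r rP] _] := dE k; exists r.
pose s := fix s j := if j is k.+1 then f (k, s k) else p.
have Ps j : P (s j) by elim: j => [//|j IH]; have [] := fP (j, s j) IH.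
exists s; first by split=> // j; have [] := fP (j, s j) (Ps j).
by move=> k; exists k.+1; have [] := fP (k, s k) (Ps k).
Qed.

Lemma generic_countable (L : Type) (S : set L) P : countable S -> generic_for S P.
Proof.
move=> /countable_injP[c c_inj] E D dE dD p Pp.
pose G (z : nat) : set T := match unpickle z : option (nat + nat * nat) with
  | Some (inl k) => E k
  | Some (inr (m, k)) => [set q | forall i, S i -> c i = m -> D i k q]
  | None => setT end.
have [|s sD sG] := @rasiowa_sikorski P G _ p Pp.
  move=> z; rewrite /G; case: (unpickle z) => [[k|[m k]]|]; [exact: dE| |exact: dense_openT].
  have [[i Si cim]|no] := pselect (exists2 i, S i & c i = m); last first.
    have -> : [set q | forall i, S i -> c i = m -> D i k q] = setT.
      by apply/seteqP; split=> // q _ i Si ci; case: no; exists i.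
    exact: dense_openT.
  suff -> : [set q | forall i, S i -> c i = m -> D i k q] = D i k by exact: dD.
  apply/seteqP; split=> [q /(_ i Si cim)//|q Dq j Sj cjm].
  by rewrite (_ : j = i) //; apply: c_inj; rewrite ?inE // cjm.
exists s; split=> // [k|i Si k].
  by have := sG (pickle (inl k : nat + nat * nat)); rewrite /G pickleK.
have [j] := sG (pickle (inr (c i, k) : nat + nat * nat)).
by rewrite /G pickleK /= => /(_ i Si erefl); exists j.
Qed.

(** The sets [E] are interleaved with each [D i] at the odd positions; a member of [S] ensures that
    they occur at all. *)
Lemma merge_generic (L : Type) (S : set L) P :
  S !=set0 ->
  (forall D : L -> nat -> set T,
    (forall i, S i -> forall k, dense_open P (D i k)) ->
    forall p, P p -> exists2 s, descending P p s &
      forall i, S i -> forall k, meets s (D i k)) ->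
  generic_for S P.
Proof.
move=> [i0 Si0] H E D dE dD p Pp.
have [|s sD sG] := H (fun i k => if odd k then E k./2 else D i k./2) _ p Pp.
  by move=> i Si k; case: ifP => _; [exact: dE|exact: dD].
exists s; split=> // [k|i Si k].
  by have := sG i0 Si0 k.*2.+1; rewrite /= odd_double /= uphalf_double.
by have := sG i Si k.*2; rewrite odd_double doubleK.
Qed.

End Forcing.

(** * Countable sets and infinite sets of natural numbers *)

Lemma countable_enum (T : Type) (P : set T) :
  countable P -> P !=set0 ->
  exists2 e : nat -> T, forall m, P (e m) & forall p, P p -> exists m, e m = p.
Proof.
move=> /countable_injP[c c_inj] [p0 Pp0].
have [e eP] : {e : nat -> T & forall m, P (e m) /\ forall p, P p -> c p = m -> e m = p}.
  apply: (@choice _ _ (fun m x => P x /\ forall p, P p -> c p = m -> x = p)) => m.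
  have [[p Pp cp]|no] := pselect (exists2 p, P p & c p = m).
    by exists p; split=> // q Pq cq; apply: c_inj; rewrite ?inE // cp.
  by exists p0; split=> // q Pq cq; case: no; exists q.
by exists e => [m|p Pp]; [case: (eP m)|exists (c p); case: (eP (c p)) => _; exact].
Qed.

Lemma infinite_unbounded (U : set nat) (f : nat -> nat) :
  (forall N, exists2 z, U z & (N <= f z)%N) -> infinite_set U.
Proof.
move=> H /finite_seqP[s Us].
have [z Uz] := H (\max_(y <- s) f y).+1.
rewrite ltnNge leq_bigmax_seq //.
by move: Uz; rewrite Us.
Qed.

Lemma infinite_large (U V : set nat) (N : nat) :
  infinite_set U -> finite_set (U `\` V) -> exists2 z, (U `&` V) z & (N <= z)%N.
Proof.
move=> Uinf Vfin; apply: contrapT => no.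
apply: Uinf; apply: (@sub_finite_set _ _ ((U `\` V) `|` `I_N)).
  move=> z Uz; have [Vz|nVz] := pselect (V z); last by left.
  right; rewrite /= ltnNge; apply/negP => Nz; apply: no; by exists z.
by rewrite finite_setU; split=> //; exact: finite_II.
Qed.

Lemma finite_large (U : set nat) : finite_set U -> exists N, forall z, U z -> (z < N)%N.
Proof.
move=> /finite_seqP[s ->]; exists (\max_(y <- s) y).+1 => z zs.
by rewrite ltnS (leq_bigmax_seq (F := id)).
Qed.

Lemma infinite_inj (L : Type) (S : set L) : infinite_set S ->
  exists2 g : nat -> L, forall k, S (g k) & injective g.
Proof.
move=> /infiniteP/card_leP[f].
exists (fun k => val (f (exist _ k (mem_set I)))).
  by move=> k; apply: set_mem; exact: valP.
move=> k l /val_inj fkl.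
have := @inj _ _ _ f _ _ (mem_set I) (mem_set I) fkl.
by move=> [].
Qed.

(** * Generic sequences below the pseudo-intersection number *)

Section PseudoIntersection.
Variables (T : Type) (le : T -> T -> Prop).
Hypothesis le_refl : forall p, le p p.
Hypothesis le_trans : forall q p r, le p q -> le q r -> le p r.

(* A code [w] prescribes, for each of the first [size w] conditions [e j], an
   extension [e (w`_j)]; it is good for [i] when these extensions lie in the
   first [size w] dense sets attached to [i]. An infinite pseudo-intersection of
   the sets of good codes yields better and better prescriptions, and following
   them from any condition meets all the dense sets. *)
Lemma generic_lt_p (L : Type) (S : set L) (P : set T) :
  countable P -> lt_p S -> generic_for le S P.
Proof.
move=> Pcount Sp.
have [/finite_set_countable Scount|Sinf] := pselect (finite_set S).
  exact: generic_countable.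
have [g Sg g_inj] := infinite_inj Sinf.
apply: merge_generic => // [|D dD p Pp]; first by exists (g 0%N).
have [|e Pe eP] := countable_enum Pcount; first by exists p.
pose dec z : seq nat := odflt [::] (unpickle z).
have decK w : dec (pickle w) = w by rewrite /dec pickleK.
pose good i : set nat := [set z |
  (forall k, g k = i -> (k <= size (dec z))%N) /\
  forall j, (j < size (dec z))%N -> le (e (nth 0%N (dec z) j)) (e j) /\
    forall k, (k < size (dec z))%N -> D i k (e (nth 0%N (dec z) j))].
have goodW i N : exists M : nat, (N <= M)%N /\ forall k, g k = i -> (k <= M)%N.
  have [[k gk]|no] := pselect (exists k, g k = i); last first.
    by exists N; split=> // k gk; case: no; exists k.
  exists (maxn N k); split; first exact: leq_maxl.
  by move=> k'; rewrite -gk => /g_inj ->; exact: leq_maxr.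
(* Finitely many demands are met by one prescription of any large length [M], so the common good
   codes have unbounded length. *)
have goodS (G : set (set nat)) : finite_set G -> G `<=` good @` S ->
    infinite_set (\bigcap_(U in G) U).
  move=> /finite_seqP[us ->] Gsub.
  have [h hP] : {h : set nat -> L & forall U, U \in us -> S (h U) /\ good (h U) = U}.
    apply: (@choice _ _ (fun U i => U \in us -> S i /\ good i = U)) => U.
    have [Uus|nU] := boolP (U \in us); last by exists (g 0%N).
    by have [i Si <-] := Gsub U Uus; exists i.
  apply: (@infinite_unbounded _ (fun z => size (dec z))) => N.
  have [M [NM MP]] : exists M, (N <= M)%N /\
      forall U k, U \in us -> g k = h U -> (k <= M)%N.
    elim: (us) => [|U us' [M [NM MP]]]; first by exists N.
    have [M' [MM' MP']] := goodW (h U) M.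
    exists M'; split=> [|V k]; first exact: leq_trans NM MM'.
    rewrite inE => /predU1P[->|Vus]; first exact: MP'.
    by move=> /(MP _ _ Vus) kM; exact: leq_trans kM MM'.
  have [v vP] : {v : nat -> nat & forall j, le (e (v j)) (e j) /\
      forall U k, U \in us -> (k < M)%N -> D (h U) k (e (v j))}.
    apply: (@choice _ _ (fun j m => le (e m) (e j) /\
      forall U k, U \in us -> (k < M)%N -> D (h U) k (e m))) => j.
    have [|q [Pq qj Dq]] := @dense_open_finite _ _ le_refl le_trans P _
      (fun Uk : set nat * nat => D (h Uk.1) Uk.2)
      [seq (U, k) | U <- us, k <- iota 0 M] _ (e j) (Pe j).
      move=> [U k] /allpairsP[[U' k'] /= [Uus _ [-> ->]]].
      by apply: dD; case: (hP U' Uus).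
    have [m em] := eP q Pq; exists m; rewrite em; split=> // U k Uus kM.
    by apply: (Dq (U, k)); apply/allpairsP; exists (U, k); rewrite mem_iota.
  exists (pickle (mkseq v M)); last by rewrite decK size_mkseq.
  move=> U /= Uus; have [_ <-] := hP U Uus.
  rewrite /good /= decK size_mkseq; split=> [k|j jM]; first exact: MP.
  rewrite nth_mkseq //; have [vj Dv] := vP j; split=> // k kM.
  exact: Dv.
(* Without such a [Q], the image of [S] under [good] would witness the pseudo-intersection number
   with at most as many sets as [S] has members. *)
have [Q Qinf QP] : exists2 Q, infinite_set Q & pseudo_intersection (good @` S) Q.
  apply: contrapT => noQ.
  have [|_ []] := Sp (good @` S); last exact: card_image_le.
  split=> // U GU; have := goodS [set U] (finite_set1 U).
  by rewrite bigcap_set1; apply=> V ->.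
have Qfin i : S i -> finite_set (Q `\` good i) by move=> Si; apply: QP; exists i.
(* Codes good for [g k] have length at least [k]; the index [maxn a.+1 j] thus makes the chosen code
   prescribe an extension of [e a]. *)
have [step stepP] : {step : nat * nat -> nat & forall aj,
    Q (step aj) /\ (aj.2 <= step aj)%N /\ good (g (maxn aj.1.+1 aj.2)) (step aj)}.
  apply: (@choice _ _ (fun aj z =>
    Q z /\ (aj.2 <= z)%N /\ good (g (maxn aj.1.+1 aj.2)) z)) => -[a j] /=.
  by have [z [Qz Gz] jz] := infinite_large j Qinf (Qfin _ (Sg (maxn a.+1 j))); exists z.
have [a0 ea0] := eP p Pp.
pose a := fix a j := if j is k.+1 then nth 0%N (dec (step (a k, k))) (a k) else a0.
have sizeP j : (maxn (a j).+1 j <= size (dec (step (a j, j))))%N.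
  by have [_ [_ [+ _]]] := stepP (a j, j); apply.
exists (e \o a); first split=> // [j|j]; first exact: Pe.
  have [_ [_ [_ /(_ (a j))[|//]]]] := stepP (a j, j).
  by apply: leq_trans (sizeP j); exact: leq_maxl.
move=> i Si k; have [N NP] := finite_large (Qfin i Si).
(* From [N] on the codes in [Q] are good for [i], and [k.+1] makes the code long enough to treat
   [D i k]. *)
pose j := maxn N k.+1; exists j.+1.
have [Qz [jz _]] := stepP (a j, j).
have [|ngood] := pselect (good i (step (a j, j))).
  move=> [_ /(_ (a j))[|_ ]]; first by apply: leq_trans (sizeP j); exact: leq_maxl.
  apply; apply: leq_trans (leq_trans _ (sizeP j)); last exact: leq_maxr.
  exact: leq_maxr.
have := NP _ (conj Qz ngood); rewrite ltnNge => /negP[].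
by apply: leq_trans jz; exact: leq_maxl.
Qed.

End PseudoIntersection.

(** * Generic sequences below the covering number of the meager ideal *)

Lemma disjoint_open_pieces (R : realType) (O : set R) : open O -> O !=set0 ->
  exists W : nat -> set R,
    (forall m, [/\ open (W m), W m !=set0 & W m `<=` O]) /\
    forall m m' x, W m x -> W m' x -> m = m'.
Proof.
move=> Oo [x Ox].
have /nbhs_ballP[r /= r0 rO] : nbhs x O by exact: open_nbhs_nbhs.
pose u (m : nat) : R := (x + r / m.+1%:R)%R.
have u_dec m m' : (m <= m')%N -> (u m' <= u m)%R.
  by move=> mm'; rewrite lerD2l ler_pM2l // lef_pV2 ?posrE ?ltr0n // ler_nat.
have u_lt m : (u m.+1 < u m)%R.
  by rewrite ltrD2l ltr_pM2l // ltf_pV2 ?posrE ?ltr0n // ltr_nat.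
have u_gt m : (x < u m)%R by rewrite ltrDl divr_gt0 // ltr0n.
have u0 : u 0%N = (x + r)%R by rewrite /u divr1.
exists (fun m => `]u m.+1, u m[%classic); split=> [m|].
  split; first exact: interval_open.
    exists ((u m.+1 + u m) / 2)%R; rewrite /= in_itv /=; have := u_lt m; lra.
  move=> y; rewrite /= in_itv /= => /andP[y1 y2]; apply: rO.
  rewrite /ball /= ltr_norml; have := u_dec _ _ (leq0n m); have := u_gt m.+1.
  rewrite u0; lra.
have wlogP m m' y : (m < m')%N -> `]u m.+1, u m[%classic y -> `]u m'.+1, u m'[%classic y -> False.
  move=> mm'; rewrite /= !in_itv /= => /andP[y1 _] /andP[_ y2].
  by have := u_dec _ _ mm'; rewrite leNgt (lt_trans y1 y2).
by move=> m m' y ym ym'; case: (ltngtP m m') => // /wlogP H; case: (H y).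
Qed.

Section MeagerCovering.
Variables (R : realType) (T : Type) (le : T -> T -> Prop).
Hypothesis le_refl : forall p, le p p.
Hypothesis le_trans : forall q p r, le p q -> le q r -> le p r.

(** Lets a whole open set of reals be steered at once to an extension of a single condition. *)
Definition generically_locally_constant (s : R -> T) : Prop :=
  forall O : set R, open O -> O !=set0 ->
    exists q O', [/\ open O', O' !=set0, O' `<=` O & forall x, O' x -> s x = q].

(** On an open part of [B] where [s] has a constant value [q], disjoint open pieces receive the
    enumerated extensions of [q], one each. *)
Lemma refine_on (P : set T) (s : R -> T) (B : set R) :
  countable P -> generically_locally_constant s -> (forall x, P (s x)) ->
  open B -> B !=set0 ->
  exists s', [/\ generically_locally_constant s', forall x, P (s' x),
    forall x, le (s' x) (s x) &
    exists2 q, P q & forall r, P r -> le r q -> exists O,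
      [/\ open O, O !=set0, O `<=` B & forall x, O x -> s' x = r]].
Proof.
move=> Pcount slc Ps Bo B0.
have [q [B' [B'o B'0 B'B sq]]] := slc B Bo B0.
have Pq : P q by have [x /sq <-] := B'0.
have [|e Pe eP] := countable_enum Pcount; first by exists q.
have [W [WP Wdisj]] := disjoint_open_pieces B'o B'0.
have [s' s'P] : {s' : R -> T & forall x,
    (forall m, W m x -> le (e m) q -> s' x = e m) /\
    ((forall m, W m x -> ~ le (e m) q) -> s' x = s x)}.
  apply: (@choice _ _ (fun x y => (forall m, W m x -> le (e m) q -> y = e m) /\
    ((forall m, W m x -> ~ le (e m) q) -> y = s x))) => x.
  have [[m [Wm em]] | no] := pselect (exists m, W m x /\ le (e m) q).
    exists (e m); split=> [m' Wm' _|/(_ m Wm)//].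
    by rewrite (Wdisj _ _ _ Wm Wm').
  by exists (s x); split=> // m Wm em; case: no; exists m.
have s'cases x : (exists m, [/\ W m x, le (e m) q & s' x = e m]) \/ s' x = s x.
  have [[m [Wm em]] | no] := pselect (exists m, W m x /\ le (e m) q).
    by left; exists m; split=> //; apply: (s'P x).1.
  by right; apply: (s'P x).2 => m Wm em; apply: no; exists m.
exists s'; split.
- move=> O Oo O0.
  have [ [m [y [Oy Wy]] em] | no] := pselect (exists2 m, O `&` W m !=set0 & le (e m) q).
    have [Wo _ _] := WP m; exists (e m), (O `&` W m); split=> //.
    + exact: openI.
    + by exists y.
    + by move=> x [_ Wx]; apply: (s'P x).1.
  have [q2 [V [Vo V0 VO sq2]]] := slc O Oo O0.
  exists q2, V; split=> // x Vx; rewrite -(sq2 x Vx).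
  apply: (s'P x).2 => m Wm em; apply: no; exists m => //; exists x.
  by split=> //; exact: VO.
- by move=> x; have [ [m [_ _ ->]] | -> ] := s'cases x; [exact: Pe|exact: Ps].
- move=> x; have [ [m [Wm em ->]] | -> ] := s'cases x; last exact: le_refl.
  by rewrite sq //; have [_ _ WB] := WP m; exact: WB.
- exists q => // r Pr rq; have [m em] := eP r Pr; have [Wo W0 WB] := WP m.
  exists (W m); split=> //; first exact: subset_trans WB B'B.
  by move=> x Wx; rewrite -em; apply: (s'P x).1 => //; rewrite em.
Qed.

(* Every real number [x] is made to code a descending sequence [j |-> s j x] so
   that each dense set is met for all [x] outside a nowhere dense set. *)
Lemma generic_lt_covK (L : Type) (S : set L) (P : set T) :
  countable P -> S !=set0 -> lt_covK R S -> generic_for le S P.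
Proof.
move=> Pcount S0 Scov; apply: merge_generic => // D dD p Pp.
pose B (j : nat) : set R :=
  if unpickle j is Some (c, r) then ball (ratr c : R) (ratr r : R) else set0.
have Bo j : open (B j).
  by rewrite /B; case: (unpickle j) => [[c r]|]; [exact: ball_open|exact: open0].
have Bbase (O : set R) : open O -> O !=set0 -> exists2 j, B j !=set0 & B j `<=` O.
  move=> Oo [x Ox]; have [c [r [/set_mem xB BO]]] := open_subball_rat Oo (mem_set Ox).
  by exists (pickle (c, r)); rewrite /B pickleK //; exists x.
have [f fP] : {f : nat * (R -> T) -> R -> T & forall js,
    generically_locally_constant js.2 -> (forall x, P (js.2 x)) ->
    [/\ generically_locally_constant (f js), forall x, P (f js x),
        forall x, le (f js x) (js.2 x) &
        B js.1 !=set0 -> exists2 q, P q & forall r, P r -> le r q -> exists O,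
        [/\ open O, O !=set0, O `<=` B js.1 & forall x, O x -> f js x = r]]}.
  apply: (@choice _ _ (fun js s' => generically_locally_constant js.2 -> (forall x, P (js.2 x)) ->
    [/\ generically_locally_constant s', forall x, P (s' x),
        forall x, le (s' x) (js.2 x) &
        B js.1 !=set0 -> exists2 q, P q & forall r, P r -> le r q -> exists O,
        [/\ open O, O !=set0, O `<=` B js.1 & forall x, O x -> s' x = r]])) => -[j s].
  have [[slc Ps]|no] := pselect (generically_locally_constant s /\ forall x, P (s x)); last first.
    by exists s => slc Ps; case: no.
  have [Bj0|/set0P/negP/negPn/eqP Bj0] := pselect (B j !=set0); last first.
    by exists s => _ _; split=> //=; rewrite Bj0 => -[].
  by have [s' [? ? ? ?]] := refine_on Pcount slc Ps (Bo j) Bj0; exists s' => _ _; split.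
pose s := fix s j := if j is k.+1 then f (k, s k) else fun=> p.
have sP j : generically_locally_constant (s j) /\ forall x, P (s j x).
  elim: j => [|j [slc Ps]]; last by have [] := fP (j, s j) slc Ps.
  by split=> // O Oo O0; exists p, O; split.
have sD x : descending le P p (s^~ x).
  split=> // j; first exact: (sP j).2.
  by have [slc Ps] := sP j; have [_ _ + _] := fP (j, s j) slc Ps; apply.
pose bad i : set R := \bigcup_k [set x | forall j, ~ D i k (s j x)].
have bad_meager i : S i -> meager (bad i).
  move=> Si; exists (fun k => [set x | forall j, ~ D i k (s j x)]) => // k.
  (* If the closure had interior points, it would contain some nonempty [B j]; but stage [j.+1] has
     a value in [D i k] on an open part of [B j]. *)
  apply/eqP; apply: contrapT => /negP/set0P O0.
  have [j Bj0 BO] := Bbase _ (@open_interior _ _) O0.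
  have [slc Ps] := sP j; have [_ _ _ /(_ Bj0)[q Pq qP]] := fP (j, s j) slc Ps.
  have [/(_ q Pq)[r [Pr rq Dr]] _] := dD i Si k.
  have [V [Vo [y Vy] VB sV]] := qP r Pr rq.
  have /interior_subset Ny := BO y (VB y Vy).
  have [z [/(_ j.+1) Nz Vz]] := Ny V (open_nbhs_nbhs (conj Vo Vy)).
  by apply: Nz; rewrite /= sV.
(* Otherwise the meager sets [bad i] would cover the line, and there are too few of them. *)
have [x xgood] : exists x, forall i, S i -> ~ bad i x.
  apply: contrapT => cover; have [|_ []] := Scov (bad @` S); last exact: card_image_le.
  split=> [_ [i Si <-]|]; first exact: bad_meager.
  apply/seteqP; split=> // x _; apply: contrapT => nx; apply: cover; exists x => i Si bx.
  by apply: nx; exists (bad i) => //; exists i.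
exists (s^~ x); first exact: sD.
move=> i Si k; apply: contrapT => no; apply: (xgood i Si); exists k => // j Dj.
by apply: no; exists j.
Qed.

End MeagerCovering.

(** * Perfect trees of conditions *)

Section PerfectTree.
Variables (T : Type) (le : T -> T -> Prop).
Hypothesis le_refl : forall p, le p p.
Hypothesis le_trans : forall q p r, le p q -> le q r -> le p r.

(* The position in its level of the vertex of the binary tree that lies on the
   branch [a]; the parent of the vertex [m] is [m./2]. *)
Fixpoint node (a : nat -> bool) (k : nat) : nat :=
  if k is k'.+1 then (a k' + (node a k').*2)%N else 0%N.

Lemma node_lt a k : (node a k < 2 ^ k)%N.
Proof.
elim: k => //= k IH; rewrite expnS mul2n.
by case: (a k); rewrite ?add0n ?ltn_double //= add1n ltn_Sdouble.
Qed.

(** The parity of a position is the last turn and its half the parent, so branches that have parted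
    stay apart. *)
Lemma node_neq a b : a <> b -> exists j, forall k, (j <= k)%N -> node a k <> node b k.
Proof.
move=> ab; have [j abj] : exists j, a j <> b j.
  by apply: contrapT => no; apply: ab; apply/funext => j;
    apply: contrapT => abj; apply: no; exists j.
exists j.+1; elim=> // k IH; rewrite leq_eqVlt => /orP[/eqP[<-] /= e|jk /= e].
  by apply: abj; have := congr1 odd e; rewrite !oddD !odd_double !addbF !oddb.
by apply: IH => //; have := congr1 half e; rewrite !half_bit_double.
Qed.

(** A whole level counts as one condition in the pointwise order; its finitely many requirements are
    then met in turn by [dense_open_finite]. *)
Lemma perfect_tree (P : set T) (E : nat -> set T) (Q : nat -> T -> T -> Prop) :
  (forall k, dense_open le P (E k)) ->
  (forall t p q, P p -> P q -> exists p' q',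
     [/\ P p', P q', le p' p, le q' q & Q t p' q']) ->
  (forall t p p' q q', le p' p -> le q' q -> Q t p q -> Q t p' q') ->
  forall p, P p -> exists s : (nat -> bool) -> nat -> T,
    (forall a, descending le P p (s a) /\ forall k, meets (s a) (E k)) /\
    forall a b t, a <> b -> exists j, Q t (s a j) (s b j).
Proof.
move=> dE dQ oQ p Pp.
pose leX (g g' : nat -> T) := forall m, le (g m) (g' m).
pose PX : set (nat -> T) := [set g | forall m, P (g m)].
pose D k (key : nat + nat * nat * nat) : set (nat -> T) := match key with
  | inl m => [set g | E k (g m)]
  | inr (m, m', t) => [set g | Q t (g m) (g m')] end.
have level kg : exists g', PX kg.2 -> [/\ PX g', leX g' kg.2,
    forall m, (m < 2 ^ kg.1.+1)%N -> E kg.1 (g' m) &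
    forall m m' t, (m < 2 ^ kg.1.+1)%N -> (m' < 2 ^ kg.1.+1)%N -> (t <= kg.1)%N ->
      m <> m' -> Q t (g' m) (g' m')].
  case: kg => k g /=; have [Pg|no] := pselect (PX g); last by exists g.
  have [||key|g' [Pg' g'g Dg']] := @dense_open_finite _ leX _ _ PX _ (D k)
    ([seq inl m | m <- iota 0 (2 ^ k.+1)] ++
     [seq inr mt | mt <- [seq mt <- [seq (mm, t) |
         mm <- [seq (m, m') | m <- iota 0 (2 ^ k.+1), m' <- iota 0 (2 ^ k.+1)],
         t <- iota 0 k.+1] | mt.1.1 != mt.1.2]]) _ g Pg.
  - by move=> h m; exact: le_refl.
  - by move=> h1 h2 h3 l1 l2 m; exact: le_trans (l1 m) (l2 m).
  - rewrite mem_cat => /orP[/mapP[m _ ->]|/mapP[[[m m'] t]]].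
      split=> [h Ph|h h' hh'] /=; last by have [_] := dE k; apply.
      have [/(_ (h m) (Ph m))[q [Pq qh Eq]] _] := dE k.
      exists (fun i => if i == m then q else h i); split=> [i|i|] /=; rewrite ?eqxx //.
        by case: ifP.
      by case: eqP => [->//|_]; exact: le_refl.
    rewrite mem_filter => /andP[/= mm' _ ->]; split=> [h Ph|h h' hh'] /=; last exact: oQ.
    have [q [q' [Pq Pq' qh q'h Qq]]] := dQ t _ _ (Ph m) (Ph m').
    exists (fun i => if i == m then q else if i == m' then q' else h i).
    split=> [i|i|] /=; first by case: ifP => // _; case: ifP.
      by case: eqP => [->//|_]; case: eqP => [->//|_]; exact: le_refl.
    by rewrite eqxx eq_sym (negbTE mm') eqxx.
  exists g' => _; split=> // [m mk|m m' t mk m'k tk mm'].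
    by apply: (Dg' (inl m)); rewrite mem_cat map_f // mem_iota.
  apply: (Dg' (inr (m, m', t))); rewrite mem_cat; apply/orP; right.
  apply: map_f; rewrite mem_filter; apply/andP; split; first exact/eqP.
  apply/allpairsP; exists ((m, m'), t); rewrite mem_iota; split=> //.
  by apply/allpairsP; exists (m, m'); rewrite !mem_iota.
have [f fP] := choice level.
(* Both children of a vertex start from the condition at their parent [m./2]. *)
pose G := fix G k := if k is k'.+1 then f (k', fun m => G k' m./2) else fun=> p.
have PG k : PX (G k).
  elim: k => [|k IH]; first by move=> m.
  by have [] := fP (k, fun m => G k m./2) (fun m => IH m./2).
have GS k := fP (k, fun m => G k m./2) (fun m => PG k m./2).
exists (fun a k => G k (node a k)); split=> [a|a b t ab].
  split.
    split=> // [j|j]; first exact: PG.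
    by have [_ /(_ (node a j.+1)) /= + _ _] := GS j; rewrite half_bit_double.
  move=> k; exists k.+1; have [_ _ /(_ (node a k.+1)) + _] := GS k.
  by apply; exact: node_lt.
have [j abj] := node_neq ab; exists (maxn j t).+1.
have [_ _ _] := GS (maxn j t); apply; try exact: node_lt.
  exact: leq_maxr.
by apply: abj; apply: leqW; exact: leq_maxl.
Qed.

End PerfectTree.

(** * Substitutions in cylindric algebras *)

Section CylindricArithmetic.
Variables (I : Type) (B : cylAlg I).
Implicit Types (x y z : B) (i j k l : I).
Local Open Scope order_scope.

Lemma cyl_mono i x y : x <= y -> cyl i x <= cyl i y.
Proof.
move=> xy; have := cyl_meet i x y.
have -> : x `&` cyl i y = x by apply/meet_idPl/(le_trans xy)/cyl_ext.
by move=> ->; exact: leIr.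
Qed.

Lemma cyl_top i : cyl i \top = \top :> B.
Proof. by apply/le_anti; rewrite lex1 cyl_ext. Qed.

Lemma cyl_idem i x : cyl i (cyl i x) = cyl i x.
Proof. by have := cyl_meet i \top x; rewrite cyl_top !meet1x. Qed.

Lemma cyl_eq0 i x : cyl i x = \bot -> x = \bot.
Proof. by move=> e; apply/le_anti; rewrite le0x -e cyl_ext. Qed.

Lemma cyl_meetr i x y : cyl i y = y -> cyl i (x `&` y) = cyl i x `&` y.
Proof. by move=> cy; rewrite -{1}cy cyl_meet cy. Qed.

Lemma cyl_meetl i x y : cyl i x = x -> cyl i (x `&` y) = x `&` cyl i y.
Proof. by move=> cx; rewrite meetC cyl_meetr // meetC. Qed.

Lemma closed_meet i x y : cyl i x = x -> cyl i y = y -> cyl i (x `&` y) = x `&` y.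
Proof. by move=> cx cy; rewrite cyl_meetr // cx. Qed.

Lemma closed_compl i x : cyl i x = x -> cyl i (~` x) = ~` x.
Proof.
move=> cx; apply/le_anti; rewrite cyl_ext andbT -disj_leC.
by rewrite -cyl_meetr // meetCx cyl_bot.
Qed.

Lemma closed_cyl i j x : cyl i x = x -> cyl i (cyl j x) = cyl j x.
Proof. by move=> cx; rewrite cyl_comm cx. Qed.

(** As [cyl k] of the meet of the two diagonals is [diag B l l], the top, [diag_cyl] leaves nothing
    of [diag B k l] outside [diag B l k]. *)
Lemma diag_sym i j : diag B i j = diag B j i.
Proof.
suff le_ij k l : diag B k l <= diag B l k by apply/le_anti; rewrite !le_ij.
have [->|kl] := pselect (k = l); first exact: lexx.
have e : cyl k (diag B k l `&` diag B l k) = \top.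
  by rewrite meetC -diag_trans ?diag_refl.
have := @diag_cyl _ B k l (diag B l k) kl; rewrite e meet1x => /cyl_eq0/eqP.
by rewrite disj_leC complK.
Qed.

Lemma closed_diag k i j : k <> i -> k <> j -> cyl k (diag B i j) = diag B i j.
Proof. by move=> ki kj; rewrite (@diag_trans _ B _ _ _ ki kj) cyl_idem. Qed.

Lemma cyl_diag i j : cyl i (diag B i j) = \top.
Proof.
have [->|ij] := pselect (i = j); first by rewrite diag_refl cyl_top.
apply/le_anti; rewrite lex1 /= -(diag_refl B j).
have ji : i <> j by [].
by rewrite (@diag_trans _ B j j i) //; apply: cyl_mono; exact: leIr.
Qed.

Lemma diag_trans_le i j k : diag B i j `&` diag B j k <= diag B i k.
Proof.
have [->|ji] := pselect (j = i); first exact: leIr.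
have [->|jk] := pselect (j = k); first exact: leIl.
by rewrite [leRHS](@diag_trans _ B _ _ _ ji jk); exact: cyl_ext.
Qed.

(* The substitution of [j] for [i], written s^i_j in the literature. *)
Definition sub1 i j x : B := cyl i (diag B i j `&` x).

Lemma sub1_mono i j x y : x <= y -> sub1 i j x <= sub1 i j y.
Proof. by move=> xy; apply: cyl_mono; rewrite leI2. Qed.

Lemma sub1_closed i j x : cyl i x = x -> sub1 i j x = x.
Proof. by move=> cx; rewrite /sub1 cyl_meetr // cyl_diag meet1x. Qed.

Lemma diag_sub1_le i j x : i <> j -> diag B i j `&` sub1 i j x <= x.
Proof.
move=> ij; suff : diag B i j `&` sub1 i j x `&` ~` x == \bot by rewrite disj_leC complK.
rewrite -lex0 -(diag_cyl x ij) -meetA meetCA leI2 //.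
exact: cyl_ext.
Qed.

(** The universal reading of [sub1], which is defined existentially; it yields preservation of meets
    and complements. *)
Lemma le_sub1 i j x y : i <> j -> cyl i y = y -> (y <= sub1 i j x) = (diag B i j `&` y <= x).
Proof.
move=> ij cy; apply/idP/idP => H.
  by apply: le_trans (diag_sub1_le x ij); rewrite leI2.
rewrite -[y](sub1_closed j cy); apply: cyl_mono.
by rewrite lexI leIl.
Qed.

Lemma cyl_sub1 i j x : cyl i (sub1 i j x) = sub1 i j x.
Proof. exact: cyl_idem. Qed.

Lemma sub1_meet i j x y : i <> j -> sub1 i j (x `&` y) = sub1 i j x `&` sub1 i j y.
Proof.
move=> ij; apply/le_anti/andP; split.
  by rewrite lexI !sub1_mono ?leIl ?leIr.
rewrite le_sub1 ?closed_meet ?cyl_sub1 // lexI; apply/andP; split.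
  by apply: le_trans (diag_sub1_le x ij); rewrite leI2 // leIl.
by apply: le_trans (diag_sub1_le y ij); rewrite leI2 // leIr.
Qed.

Lemma sub1_compl i j x : i <> j -> sub1 i j (~` x) = ~` sub1 i j x.
Proof.
move=> ij; apply/le_anti/andP; split.
  by rewrite -disj_leC meetC; apply/eqP; exact: diag_cyl.
rewrite le_sub1 //; last exact/closed_compl/cyl_sub1.
rewrite -disj_leC -meetA [_ `&` x]meetC meetA disj_leC complK.
exact: cyl_ext.
Qed.

Lemma sub1_diag m k (r : I -> I) i j : m <> k -> r m = k ->
  (forall l, l <> m -> r l = l) -> sub1 m k (diag B i j) = diag B (r i) (r j).
Proof.
move=> mk rm rE; have [->|im] := pselect (i = m); have [->|jm] := pselect (j = m);
  rewrite ?rm ?(rE _ im) ?(rE _ jm).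
- by rewrite !diag_refl sub1_closed ?cyl_top.
- by rewrite /sub1 (diag_sym m k) -diag_trans //; exact: nesym.
- by rewrite /sub1 meetC -diag_trans //; exact: nesym.
- by rewrite sub1_closed // closed_diag //; exact: nesym.
Qed.

Lemma cyl_sub1_comm m i j x : m <> i -> m <> j -> cyl m (sub1 i j x) = sub1 i j (cyl m x).
Proof.
move=> mi mj; rewrite /sub1 cyl_comm; congr cyl.
by rewrite cyl_meetl // closed_diag.
Qed.

(** Cylindrifying along a fresh [k] turns the diagonal into the top. This is the algebraic source of
    Henkin witnesses. *)
Lemma cyl_sub1_fresh k i x : k <> i -> cyl k x = x -> cyl k (sub1 i k x) = cyl i x.
Proof.
move=> ki cx; rewrite /sub1 cyl_comm; congr cyl.
by rewrite cyl_meetr // diag_sym cyl_diag meet1x.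
Qed.

Lemma sub1_eq0_fresh k i x : k <> i -> cyl k x = x -> sub1 i k x = \bot -> x = \bot.
Proof.
move=> ki cx /cyl_eq0 d0; have := congr1 (cyl k) d0.
by rewrite cyl_bot cyl_meetr // diag_sym cyl_diag meet1x.
Qed.

End CylindricArithmetic.

(** * Simultaneous substitution of constants *)

Section Substitutions.
Variables (n : nat) (B : cylAlg nat).
Implicit Types (x y p : B) (s t : 'I_n -> nat) (l : seq 'I_n) (i j m : 'I_n).
Local Open Scope order_scope.

(* Simultaneous substitution of the indices [n + s i] for the indices [i] in [l];
   as the new indices are outside ['I_n], it is a composition of single
   substitutions whatever [s] is. *)
Definition subs s l x : B := foldr (fun i => sub1 (B := B) i (n + s i)%N) x l.

Lemma ord_neq_shift i k : (i : nat) <> (n + k)%N.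
Proof. by have := ltn_ord i; lia. Qed.
Hint Resolve ord_neq_shift : core.

Lemma ord_neq i j : i != j -> (i : nat) <> j.
Proof. by move=> ij /val_inj/eqP; rewrite (negbTE ij). Qed.

Lemma subs_meet s l x y : subs s l (x `&` y) = subs s l x `&` subs s l y.
Proof. by elim: l => //= i l ->; exact: sub1_meet. Qed.

Lemma subs_compl s l x : subs s l (~` x) = ~` subs s l x.
Proof. by elim: l => //= i l ->; exact: sub1_compl. Qed.

Lemma subs_closed s l x : {in l, forall i, cyl (i : nat) x = x} -> subs s l x = x.
Proof.
elim: l => //= i l IH lx; rewrite IH; first by apply/sub1_closed/lx/mem_head.
by move=> j jl; apply: lx; rewrite inE jl orbT.
Qed.

Lemma subs_top s l : subs s l \top = \top.
Proof. by apply: subs_closed => i _; exact: cyl_top. Qed.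

Lemma subs_bot s l : subs s l \bot = \bot.
Proof. by apply: subs_closed => i _; exact: cyl_bot. Qed.

Lemma eq_subs s t l x : {in l, s =1 t} -> subs s l x = subs t l x.
Proof.
elim: l => //= i l IH st; rewrite st ?mem_head // IH // => j jl.
by apply: st; rewrite inE jl orbT.
Qed.

Lemma subs_diag s l i j : uniq l ->
  let r i := if i \in l then (n + s i)%N else i : nat in
  subs s l (diag B i j) = diag B (r i) (r j).
Proof.
elim: l => //= m l IH /andP[ml /IH ->].
pose r' (k : nat) := if k == m then (n + s m)%N else k.
have rE k : r' (if k \in l then (n + s k)%N else k) =
    if k \in m :: l then (n + s k)%N else k.
  rewrite /r' inE; case: (eqVneq k m) => [->|km]; first by rewrite (negbTE ml) eqxx.
  case: (k \in l) => /=; case: ifP => // /eqP; last by move/val_inj/eqP; rewrite (negbTE km).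
  by move=> e; case: (@ord_neq_shift m (s k)).
rewrite (@sub1_diag _ _ _ _ r') ?rE // /r' ?eqxx //.
by move=> k /eqP/negbTE ->.
Qed.

Lemma cyl_subs_comm (k : nat) s l x : {in l, forall i, k <> i :> nat /\ k <> (n + s i)%N} ->
  cyl k (subs s l x) = subs s l (cyl k x).
Proof.
elim: l => //= i l IH kl; have [ki ksi] := kl i (mem_head _ _).
rewrite cyl_sub1_comm // IH // => j jl.
by apply: kl; rewrite inE jl orbT.
Qed.

Lemma cyl_subs_in s l i x : i \in l -> cyl (i : nat) (subs s l x) = subs s l x.
Proof.
elim: l => //= j l IH; rewrite inE; case: (eqVneq i j) => [-> _|ij /= il].
  exact: cyl_sub1.
by rewrite cyl_sub1_comm ?IH //; exact: ord_neq.
Qed.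

Definition upd s i (k : nat) : 'I_n -> nat := fun j => if j == i then k else s j.

Lemma split_enum i : exists l1 l2, [/\ enum 'I_n = l1 ++ i :: l2, i \notin l1 & i \notin l2].
Proof.
have := enum_uniq 'I_n; have := mem_enum 'I_n i.
case/splitPr => l1 l2; rewrite cat_uniq /= => /and3P[_ /norP[il1 _] /andP[il2 _]].
by exists l1, l2.
Qed.

Lemma subs_cat s l1 i l2 x :
  subs s (l1 ++ i :: l2) x = subs s l1 (sub1 (i : nat) (n + s i)%N (subs s l2 x)).
Proof. by rewrite /subs foldr_cat. Qed.

Lemma subs_upd_notin s i k l x : i \notin l -> subs (upd s i k) l x = subs s l x.
Proof. by move=> il; apply: eq_subs => j jl; rewrite /upd; case: eqP il => // <-; rewrite jl. Qed.

(** Once [cyl i] has moved past [l2], the substitution for [i] acts on an [i]-closed element and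
    disappears. *)
Lemma subs_cyl_split s i l1 l2 x : i \notin l2 ->
  subs s (l1 ++ i :: l2) (cyl (i : nat) x) = subs s l1 (cyl (i : nat) (subs s l2 x)).
Proof.
move=> il2; rewrite subs_cat; congr (subs _ _ _).
rewrite cyl_subs_comm; last first.
  by move=> j jl2; split=> //; apply: ord_neq; apply: contraNneq il2 => ->.
rewrite sub1_closed // -cyl_subs_comm ?cyl_idem //.
by move=> j jl2; split=> //; apply: ord_neq; apply: contraNneq il2 => ->.
Qed.

Lemma subs_upd_cyl s i k x :
  subs (upd s i k) (enum 'I_n) (cyl (i : nat) x) = subs s (enum 'I_n) (cyl (i : nat) x).
Proof.
have [l1 [l2 [-> il1 il2]]] := split_enum i.
by rewrite !subs_cyl_split // !subs_upd_notin.
Qed.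

Lemma subs_cyl_fresh s i k x : cyl (n + k)%N x = x -> (forall j, s j <> k) ->
  subs s (enum 'I_n) (cyl (i : nat) x) = cyl (n + k)%N (subs (upd s i k) (enum 'I_n) x).
Proof.
move=> cx sk; have [l1 [l2 [-> il1 il2]]] := split_enum i.
rewrite subs_cyl_split // subs_cat !(subs_upd_notin _ _ _ il1, subs_upd_notin _ _ _ il2).
have fresh l : {in l, forall j, (n + k)%N <> j :> nat /\ (n + k)%N <> (n + s j)%N}.
  by move=> j _; split; [exact: nesym|have := sk j; lia].
rewrite [RHS]cyl_subs_comm; last exact: fresh.
rewrite /upd eqxx cyl_sub1_fresh //; first exact: nesym.
by rewrite cyl_subs_comm ?cx //; exact: fresh.
Qed.

(** Below [e] the diagonal linking [i] to [n + s i] passes to [n + t i] by transitivity; being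
    closed, [e] can be carried inside every cylindrification. *)
Lemma subs_equiv e s t l x : {in l, forall i, cyl (i : nat) e = e} ->
  {in l, forall i, e <= diag B (n + s i)%N (n + t i)%N} ->
  e `&` subs s l x <= subs t l x.
Proof.
elim: l => [|i l IH] ce le /=; first exact: leIr.
rewrite /sub1 -cyl_meetl ?ce ?mem_head //; apply: cyl_mono.
rewrite lexI; apply/andP; split.
  apply: le_trans (diag_trans_le _ _ (n + s i)%N _).
  rewrite lexI; apply/andP; split; first by rewrite meetCA leIl.
  by apply: le_trans (leIl _ _) _; apply: le; exact: mem_head.
apply: le_trans (IH _ _); first by rewrite leI2 // leIr.
- by move=> j jl; apply: ce; rewrite inE jl orbT.
- by move=> j jl; apply: le; rewrite inE jl orbT.
Qed.

(** Distinct indices get distinct constants [n + i], each fresh when it is substituted, so the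
    substitutions can be undone one at a time. *)
Lemma subs_val_eq0 l x : uniq l -> (forall k, (n <= k)%N -> cyl k x = x) ->
  subs (@nat_of_ord n) l x = \bot -> x = \bot.
Proof.
elim: l => //= i l IH /andP[il ul] cx e0.
apply: IH => //; apply: (sub1_eq0_fresh _ _ e0); first exact: nesym.
rewrite cyl_subs_comm ?cx ?leq_addr // => j jl; split; first exact: nesym.
have : i != j by apply: contraNneq il => ->.
by move/ord_neq; lia.
Qed.

Definition finite_support x : Prop := exists N, forall k, (N <= k)%N -> cyl k x = x.

(** Each step trades the outermost substitution for a meet of [p] with a diagonal; the meet is
    nonzero because cylindrifying it along [i] gives back [p]. *)
Lemma subs_lower_bound (X : set B) s l p : uniq l ->
  {in l, forall i, cyl (i : nat) p = p} -> finite_support p -> p <> \bot ->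
  (forall x, X x -> p <= subs s l x) ->
  exists q, [/\ q <> \bot, finite_support q & forall x, X x -> q <= x].
Proof.
elim: l p => [|i l IH] p /=; first by move=> _ _ ? ? ?; exists p.
move=> /andP[il ul] cp [N pN] p0 pX.
have cip : cyl (i : nat) p = p by apply: cp; exact: mem_head.
apply: (IH (diag B i (n + s i)%N `&` p)) => //.
- move=> j jl; rewrite closed_meet //; last by apply: cp; rewrite inE jl orbT.
  by rewrite closed_diag //; apply: ord_neq; apply: contraNneq il => <-.
- exists (maxn N (n + s i).+1)%N => k; rewrite geq_max => /andP[Nk sk].
  by rewrite closed_meet ?pN // closed_diag //; have := ltn_ord i; lia.
- move=> d0; apply: p0; rewrite -(sub1_closed (n + s i)%N cip) /sub1 d0.
  exact: cyl_bot.
- by move=> x Xx; rewrite -le_sub1 //; exact: pX.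
Qed.

(** By finite support, cylindrifying along all indices from [n] on is a finite composition; it gives
    the least neat element above [p]. *)
Lemma cyl_many_closed p : finite_support p ->
  exists q, [/\ p <= q, forall k, (n <= k)%N -> cyl k q = q &
    forall x, (forall k, (n <= k)%N -> cyl k x = x) -> p <= x -> q <= x].
Proof.
move=> [N pN]; pose q := foldr (@cyl _ B) p (iota n (N - n)).
exists q; split.
- rewrite /q; elim: (iota _ _) => //= k ks IH; apply: le_trans IH _; exact: cyl_ext.
- move=> k nk; have [Nk|kN] := leqP N k.
    rewrite /q; elim: (iota _ _) => /= [|j ks IH]; first exact: pN.
    exact: closed_cyl.
  have : k \in iota n (N - n) by rewrite mem_iota; lia.
  rewrite /q; elim: (iota _ _) => //= j ks IH; rewrite inE => /predU1P[->|/IH].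
    exact: cyl_idem.
  exact: closed_cyl.
- move=> x cx px; rewrite /q.
  have : {in iota n (N - n), forall k, cyl k x = x}.
    by move=> k; rewrite mem_iota => /andP[nk _]; exact: cx.
  elim: (iota _ _) => //= k ks IH H.
  rewrite -(H k (mem_head _ _)); apply: cyl_mono; apply: IH => j jks.
  by apply: H; rewrite inE jks orbT.
Qed.

End Substitutions.

(** * Models from descending sequences of conditions *)

Record neat_embedding (n : nat) (A : cylAlg 'I_n) (B : cylAlg nat) (h : A -> B) : Prop :=
  NeatEmbedding {
  ne_bot : h \bot%O = \bot%O;
  ne_top : h \top%O = \top%O;
  ne_meet : forall x y, h (x `&` y)%O = (h x `&` h y)%O;
  ne_compl : forall x, h (~` x)%O = (~` h x)%O;
  ne_cyl : forall (i : 'I_n) x, h (cyl i x) = cyl (i : nat) (h x);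
  ne_diag : forall i j : 'I_n, h (diag A i j) = diag B i j;
  ne_neat : forall x k, (n <= k)%N -> cyl k (h x) = h x;
  ne_eq0 : forall x, h x = \bot%O -> x = \bot%O;
  ne_inf : forall X : set A, nonprincipal_type X -> forall b : B,
    (forall k, (n <= k)%N -> cyl k b = b) -> (forall x, X x -> (b <= h x)%O) ->
    b = \bot%O }.

Lemma hom_le_inj (I : Type) (A B : cylAlg I) (f : A -> B) x y :
  cyl_hom f -> injective f -> (f x <= f y)%O -> (x <= y)%O.
Proof. by move=> hf f_inj; rewrite !leEmeet -(hom_meet hf) => /eqP/f_inj/eqP. Qed.

Lemma hom_le (I : Type) (A B : cylAlg I) (f : A -> B) x y :
  cyl_hom f -> (x <= y)%O -> (f x <= f y)%O.
Proof. by move=> hf; rewrite !leEmeet -(hom_meet hf) => /eqP ->. Qed.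

(** The complements of a type have sum one in the copy of [A], hence in [C]. The complement of a
    neat lower bound of the type bounds them from above, so the lower bound is zero. *)
Lemma ScNr_neat_embedding (n : nat) (A : cylAlg 'I_n) :
  ScNrCA A -> exists (B : cylAlg nat) (h : A -> B), neat_embedding h.
Proof.
move=> [C [B [_ [g [hg g_inj gran]]]] [S [_ Scompl] [_ [f [hf f_inj fran]]]]].
have Sf x : S (f x) by rewrite -fran; exists x.
have neat_g c : neat n B (g c) by rewrite -gran; exists c.
exists B, (g \o f); split=> /=.
- by rewrite (hom_bot hf) (hom_bot hg).
- by rewrite (hom_top hf) (hom_top hg).
- by move=> x y; rewrite (hom_meet hf) (hom_meet hg).
- by move=> x; rewrite (hom_compl hf) (hom_compl hg).
- by move=> i x; rewrite (hom_cyl hf) (hom_cyl hg).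
- by move=> i j; rewrite (hom_diag hf) (hom_diag hg).
- by move=> x k; exact: neat_g.
- by move=> x; rewrite -(hom_bot hg) => /g_inj; rewrite -(hom_bot hf) => /f_inj.
move=> X [_ Xinf] b bneat bX.
have [c _ gc] : range g b by rewrite gran.
have [||_ supX] := Scompl [set f (~` x)%O | x in X]; first by move=> _ [x _ <-].
  split; first by rewrite -(hom_top hf).
    by move=> y _; exact: lex1.
  move=> d; rewrite -{1}fran => -[d' _ <-] ub.
  rewrite -(hom_top hf); apply: hom_le => //.
  rewrite -compl0 leCx; apply: Xinf => x Xx; rewrite leCx.
  by apply: (hom_le_inj hf) => //; apply: ub; exists x.
have : (\top <= ~` c)%O.
  apply: supX => _ [x Xx <-]; rewrite (hom_compl hf) leC.
  by apply: (hom_le_inj hg) => //; rewrite gc; exact: bX.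
rewrite -compl0 leC lex0 => /eqP c0.
by rewrite -gc c0 (hom_bot hg).
Qed.

Record set_hom (n : nat) (W : Type) (A : cylAlg 'I_n) (V : set ('I_n -> W))
    (f : A -> set ('I_n -> W)) : Prop := SetHom {
  sh_bot : f \bot%O = set0;
  sh_top : f \top%O = V;
  sh_meet : forall x y, f (x `&` y)%O = f x `&` f y;
  sh_compl : forall x, f (~` x)%O = V `\` f x;
  sh_cyl : forall i x, f (cyl i x) = set_cyl V i (f x);
  sh_diag : forall i j, f (diag A i j) = set_diag V i j }.

(** * Conditions and their dense sets *)

Section Model.
Variables (n : nat) (A : cylAlg 'I_n) (B : cylAlg nat) (h : A -> B).
Hypothesis hE : neat_embedding h.
Local Open Scope order_scope.
Implicit Types (s t : 'I_n -> nat) (x y : A) (p q : B).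

(* [sb s x] says that the tuple of the constants [n + s i] satisfies [x]. *)
Definition sb s x : B := subs s (enum 'I_n) (h x).

(** Tuples are stored as finite functions, which form a countable type; conditions are then
    countable when [A] is. *)
Definition sb_meets (L : seq ({ffun 'I_n -> nat} * A)) : B :=
  foldr (fun (sx : {ffun 'I_n -> nat} * A) b => sb sx.1 sx.2 `&` b) \top L.

Definition conditions : set B := [set p | p <> \bot /\ exists L, p = sb_meets L].

Definition ext p q : Prop := p <= q.

Lemma ext_refl p : ext p p. Proof. exact: lexx. Qed.
Lemma ext_trans q p r : ext p q -> ext q r -> ext p r.
Proof. exact: le_trans. Qed.

Lemma sb_meet s x y : sb s (x `&` y) = sb s x `&` sb s y.
Proof. by rewrite /sb (ne_meet hE) subs_meet. Qed.

Lemma sb_compl s x : sb s (~` x) = ~` sb s x.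
Proof. by rewrite /sb (ne_compl hE) subs_compl. Qed.

Lemma sb_top s : sb s \top = \top.
Proof. by rewrite /sb (ne_top hE) subs_top. Qed.

Lemma sb_bot s : sb s \bot = \bot.
Proof. by rewrite /sb (ne_bot hE) subs_bot. Qed.

Lemma sb_mono s x y : x <= y -> sb s x <= sb s y.
Proof. by rewrite !leEmeet -sb_meet => /eqP ->. Qed.

Lemma sb_diag s i j : sb s (diag A i j) = diag B (n + s i)%N (n + s j)%N.
Proof. by rewrite /sb (ne_diag hE) subs_diag ?enum_uniq // !mem_enum. Qed.

Lemma sb_cyl_fresh s i k x : (forall j, s j <> k) ->
  sb s (cyl i x) = cyl (n + k)%N (sb (upd s i k) x).
Proof.
move=> sk; rewrite /sb (ne_cyl hE); apply: subs_cyl_fresh => //.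
by apply: (ne_neat hE); exact: leq_addr.
Qed.

Lemma sb_upd_le_cyl s i k x : sb (upd s i k) x <= sb s (cyl i x).
Proof.
apply: le_trans (sb_mono _ (cyl_ext i x)) _.
by rewrite /sb (ne_cyl hE) subs_upd_cyl.
Qed.

Lemma sb_finite_support s x : finite_support (sb s x).
Proof.
exists (n + \max_i (s i)).+1 => k kN; rewrite cyl_subs_comm.
  by rewrite (ne_neat hE) //; lia.
move=> j _; have := ltn_ord j; have : (s j <= \max_i s i)%N by exact: leq_bigmax.
lia.
Qed.

Lemma condition_closed p (i : 'I_n) : conditions p -> cyl (i : nat) p = p.
Proof.
move=> [_ [L ->]]; elim: L => [|[s x] L IH] /=; first exact: cyl_top.
by rewrite closed_meet // cyl_subs_in // mem_enum.
Qed.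

Lemma condition_finite_support p : conditions p -> finite_support p.
Proof.
move=> [_ [L ->]]; elim: L => [|[s x] L [N IH]] /=; first by exists 0%N => k _; exact: cyl_top.
have [N' IH'] := sb_finite_support s x; exists (maxn N N') => k.
by rewrite geq_max => /andP[kN kN']; rewrite closed_meet ?IH ?IH'.
Qed.

Lemma condition_meet p s x : conditions p -> p `&` sb s x <> \bot -> conditions (p `&` sb s x).
Proof.
move=> [_ [L ->]] n0; split=> //; exists (([ffun i => s i], x) :: L) => /=.
rewrite meetC; congr (_ `&` _); congr (sb _ x).
by apply/funext => i; rewrite ffunE.
Qed.

Lemma countable_conditions : countable [set: A] -> countable conditions.
Proof.
move=> Acount; have [/= c c_inj] := elimT (countable_injP _) Acount.
pose code (L : seq ({ffun 'I_n -> nat} * A)) : seq ({ffun 'I_n -> nat} * nat) :=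
  [seq (sx.1, c sx.2) | sx <- L].
have code_inj : injective code.
  apply: inj_map => -[s x] [s' x'] [-> /c_inj ->] //; exact: in_setT.
have : countable (range sb_meets).
  apply: sub_countable (card_image_le _ _) _.
  by apply/countable_injP; exists (pickle \o code) => L L' _ _ /(pcan_inj pickleK)/code_inj.
apply: sub_countable; apply: subset_card_le => p [_ [L ->]].
by exists L.
Qed.

(* The only place where completeness of the embedding is used: a condition below
   all [sb s x] would yield, by undoing the substitution and quantifying away the
   remaining indices, a nonzero lower bound of [X] in the neat reduct. *)
Lemma condition_not_below (X : set A) s p : nonprincipal_type X -> conditions p ->
  exists2 x, X x & p `&` sb s (~` x) <> \bot.
Proof.
move=> Xinf Pp; apply: contrapT => no.
have pX x : X x -> p <= sb s x.
  move=> Xx; rewrite -[sb s x]complK -disj_leC -sb_compl; apply/eqP.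
  by apply: contrapT => n0; apply: no; exists x.
have [||y [x Xx <-]|q [q0 qfin qX]] :=
  @subs_lower_bound _ _ (h @` X) s (enum 'I_n) p (enum_uniq _) _ _ Pp.1.
- by move=> i _; exact: condition_closed.
- exact: condition_finite_support.
- exact: pX.
have [r [qr rneat rmin]] := cyl_many_closed n qfin.
apply: q0; apply/le_anti; rewrite le0x andbT -(ne_inf hE Xinf rneat) // => x Xx.
by apply: rmin => [k nk|]; [exact: ne_neat|apply: qX; exists x].
Qed.

Definition decide s x : set B := [set p | p <= sb s x \/ p <= sb s (~` x)].

Definition henkin s i x : set B :=
  [set p | p <= sb s (~` cyl i x) \/ exists k, p <= sb (upd s i k) x].

Definition omit (X : set A) s : set B := [set p | exists2 x, X x & p <= sb s (~` x)].

Lemma dense_decide s x : dense_open ext conditions (decide s x).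
Proof.
split=> [p Pp|p q qp [px|px]]; last 2 first.
- by left; exact: le_trans qp px.
- by right; exact: le_trans qp px.
have [p0|n0] := pselect (p `&` sb s x = \bot).
  by exists p; split=> //; [exact: ext_refl|right; rewrite sb_compl -disj_leC p0].
exists (p `&` sb s x); split; first exact: condition_meet.
  exact: leIl.
by left; exact: leIr.
Qed.

Lemma fresh_constant s p : finite_support p ->
  exists k, cyl (n + k)%N p = p /\ forall j, s j <> k.
Proof.
move=> [N pN]; exists (N + (\max_i s i).+1)%N; split; first by apply: pN; lia.
by move=> j; have : (s j <= \max_i s i)%N by [exact: leq_bigmax]; lia.
Qed.

(** For a fresh constant [k], cylindrifying the meet of [p] and [sb (upd s i k) x] gives the meet of
    [p] and [sb s (cyl i x)]; if the latter is nonzero, so is the former. *)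
Lemma dense_henkin s i x : dense_open ext conditions (henkin s i x).
Proof.
split=> [p Pp|p q qp [px|[k pk]]]; last 2 first.
- by left; exact: le_trans qp px.
- by right; exists k; exact: le_trans qp pk.
have [p0|n0] := pselect (p `&` sb s (cyl i x) = \bot).
  by exists p; split=> //; [exact: ext_refl|left; rewrite sb_compl -disj_leC p0].
have [k [pk sk]] := fresh_constant s (condition_finite_support Pp).
exists (p `&` sb (upd s i k) x); split; last by right; exists k; exact: leIr.
  apply: condition_meet => // e; apply: n0.
  by rewrite (sb_cyl_fresh _ _ sk) -cyl_meetl // e cyl_bot.
exact: leIl.
Qed.

Lemma dense_omit X s : nonprincipal_type X -> dense_open ext conditions (omit X s).
Proof.
move=> Xinf; split=> [p Pp|p q qp [x Xx px]]; last by exists x => //; exact: le_trans qp px.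
have [x Xx n0] := condition_not_below s Xinf Pp.
exists (p `&` sb s (~` x)); split; first exact: condition_meet.
  exact: leIl.
by exists x => //; exact: leIr.
Qed.

Lemma model_tasks : countable [set: A] ->
  exists2 E : nat -> set B, forall k, dense_open ext conditions (E k) &
  forall v : nat -> B, (forall k, meets v (E k)) ->
    (forall s x, meets v (decide s x)) /\ forall s i x, meets v (henkin s i x).
Proof.
move=> Acount; have [|e _ eP] := countable_enum Acount; first by exists \top.
pose task : countType := ({ffun 'I_n -> nat} * nat + {ffun 'I_n -> nat} * 'I_n * nat)%type.
pose E k : set B := match unpickle k : option task with
  | Some (inl (s, m)) => decide s (e m)
  | Some (inr (s, i, m)) => henkin s i (e m)
  | None => setT end.
exists E => [k|v vE].
  rewrite /E; case: (unpickle k) => [[[s m]|[[s i] m]]|].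
  - exact: dense_decide.
  - exact: dense_henkin.
  - exact/dense_openT/ext_refl.
have sE s : ([ffun i => s i] : {ffun 'I_n -> nat}) = s :> ('I_n -> nat).
  by apply/funext => i; rewrite ffunE.
split=> [s x|s i x]; have [m <-] := eP x I.
  have := vE (pickle (inl ([ffun i => s i], m) : task)).
  by rewrite /E pickleK sE.
have := vE (pickle (inr ([ffun i => s i], i, m) : task)).
by rewrite /E pickleK sE.
Qed.

Lemma initial_condition a : a <> \bot -> conditions (sb (@nat_of_ord n) a).
Proof.
move=> a0.
have n0 : sb (@nat_of_ord n) a <> \bot.
  move=> e; apply/a0/(ne_eq0 hE)/(subs_val_eq0 (enum_uniq _) _ e) => k.
  exact: ne_neat.
have <- : \top `&` sb (@nat_of_ord n) a = sb (@nat_of_ord n) a by rewrite meet1x.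
apply: condition_meet; last by rewrite meet1x.
split; last by exists [::].
by move=> e; apply: n0; apply/le_anti; rewrite le0x -e lex1.
Qed.

(** * The model of a descending sequence *)

Section Filter.
Variables (p0 : B) (v : nat -> B).
Hypothesis vD : descending ext conditions p0 v.
Hypothesis v_decide : forall s x, meets v (decide s x).
Hypothesis v_henkin : forall s i x, meets v (henkin s i x).

Definition holds (y : B) : Prop := exists j, v j <= y.

Lemma holds_up (y z : B) : y <= z -> holds y -> holds z.
Proof. by move=> yz [j vy]; exists j; exact: le_trans vy yz. Qed.

Lemma holds_meet (y z : B) : holds y -> holds z -> holds (y `&` z).
Proof.
move=> [j vy] [k vz]; exists (maxn j k); rewrite lexI; apply/andP; split.
  exact: le_trans (descending_le ext_refl ext_trans vD (leq_maxl j k)) vy.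
exact: le_trans (descending_le ext_refl ext_trans vD (leq_maxr j k)) vz.
Qed.

Lemma holds_bot : ~ holds \bot.
Proof.
move=> [j]; rewrite lex0 => /eqP e; case: vD => _ /(_ j) + _.
by rewrite e => -[].
Qed.

Lemma holds_compl s x : holds (sb s (~` x)) <-> ~ holds (sb s x).
Proof.
split=> [hx hx'|nx].
  by apply: holds_bot; have := holds_meet hx hx'; rewrite -sb_meet meetCx sb_bot.
by have [j [jx|jx]] := v_decide s x; [case: nx; exists j|exists j].
Qed.

Lemma holds_sb_meet s x y : holds (sb s (x `&` y)) <-> holds (sb s x) /\ holds (sb s y).
Proof.
rewrite sb_meet; split=> [H|[]]; last exact: holds_meet.
by split; apply: holds_up H; [exact: leIl|exact: leIr].
Qed.

Definition same (k l : nat) : Prop := holds (diag B (n + k)%N (n + l)%N).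

Lemma same_refl k : same k k.
Proof. by exists 0%N; rewrite diag_refl lex1. Qed.

Lemma same_sym k l : same k l -> same l k.
Proof. by rewrite /same diag_sym. Qed.

Lemma same_trans l k m : same k l -> same l m -> same k m.
Proof. by move=> kl lm; apply: holds_up (holds_meet kl lm); exact: diag_trans_le. Qed.

(** The base of the model: least members of the classes of [same], in place of a quotient. *)
Definition reps : set nat := [set k | forall l, same k l -> (k <= l)%N].

Lemma rep_exists k : exists2 l, reps l & same k l.
Proof.
have ex : exists l, `[< same k l >] by exists k; apply/asboolP; exact: same_refl.
have := ex_minnP ex; move=> [l /asboolP kl lmin].
by exists l => // m lm; apply: lmin; apply/asboolP; exact: same_trans lm.
Qed.

Lemma rep_eq k l : reps k -> reps l -> same k l -> k = l.
Proof. by move=> rk rl kl; apply/anti_leq; rewrite rk ?rl //; exact: same_sym. Qed.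

Lemma holds_equiv s t x : (forall i, same (s i) (t i)) -> holds (sb s x) -> holds (sb t x).
Proof.
move=> st [j0 vx].
have [j vj] : {j : 'I_n -> nat & forall i, v (j i) <= diag B (n + s i)%N (n + t i)%N}.
  exact: choice st.
(* The sequence descends, so its term [m] is below [sb s x] and below all the finitely many
   diagonals. *)
pose m := maxn j0 (\max_i j i).
have mj i : (j i <= m)%N by apply: leq_trans (leq_maxr _ _); exact: leq_bigmax.
have vm k : (k <= m)%N -> v m <= v k by move=> km; exact: (descending_le ext_refl ext_trans vD km).
exists m; have <- : v m `&` sb s x = v m.
  by apply/meet_idPl/(le_trans _ vx)/vm; exact: leq_maxl.
apply: subs_equiv => i _; last exact: le_trans (vm _ (mj i)) (vj i).
by apply: condition_closed; case: vD.
Qed.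

Definition model (x : A) : set ('I_n -> nat) := [set t | power reps t /\ holds (sb t x)].

Lemma model_nonempty s x : holds (sb s x) -> model x !=set0.
Proof.
move=> sx; have [t tP] : {t : 'I_n -> nat & forall i, reps (t i) /\ same (s i) (t i)}.
  apply: (@choice _ _ (fun i k => reps k /\ same (s i) k)) => i.
  by have [k rk sk] := rep_exists (s i); exists k.
exists t; split; first by move=> i; case: (tP i).
by apply: holds_equiv sx => i; case: (tP i).
Qed.

Lemma model_set_hom : set_hom (power reps) model.
Proof.
split.
- by apply/seteqP; split=> // t [_]; rewrite sb_bot => /holds_bot.
- apply/seteqP; split=> [t []//|t rt]; split=> //.
  by exists 0%N; rewrite sb_top lex1.
- move=> x y; apply/seteqP; split=> [t [rt /holds_sb_meet[]]//|t [[rt tx] [_ ty]]].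
  by split=> //; apply/holds_sb_meet.
- move=> x; apply/seteqP; split=> [t [rt /holds_compl tx]|t [rt tx]]; split=> //.
    by move=> [].
  by apply/holds_compl => tx'; apply: tx.
- move=> i x; apply/seteqP; split=> [t [rt tx]|t [rt [u [ru ux] ut]]]; split=> //.
    (* The first alternative contradicts [tx]; in the second, the representative of the witness [k]
       becomes the value at [i]. *)
    have [j [jx|[k jk]]] := v_henkin t i x.
      suff /holds_compl/(_ tx) : holds (sb t (~` cyl i x)) by [].
      by exists j.
    have [l rl kl] := rep_exists k.
    exists (upd t i l); last by move=> m mi; rewrite /upd; case: eqP.
    split; first by move=> m; rewrite /upd; case: eqP.
    apply: (@holds_equiv (upd t i k)); last by exists j.
    by move=> m; rewrite /upd; case: eqP => // _; exact: same_refl.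
  apply: holds_up ux; rewrite (_ : u = upd t i (u i)); first exact: sb_upd_le_cyl.
  by apply/funext => m; rewrite /upd; case: eqP => [->//|mi]; exact: ut.
- move=> i j; apply/seteqP; split=> [t [rt]|t [rt e]]; rewrite /set_diag /model /= sb_diag.
    by move=> /(rep_eq (rt i) (rt j)).
  by split=> //; rewrite e; exact: same_refl.
Qed.

End Filter.

End Model.

(** * Set algebras from homomorphisms *)

Section SetHom.
Variables (n : nat) (W : Type) (A : cylAlg 'I_n) (V : set ('I_n -> W)).
Variable f : A -> set ('I_n -> W).
Hypothesis fH : set_hom V f.

Lemma set_hom_sub x : f x `<=` V.
Proof. by rewrite -(sh_top fH) -[x in f x](meetx1 x) (sh_meet fH) => t []. Qed.

Lemma set_hom_join x y : f (x `|` y)%O = f x `|` f y.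
Proof.
rewrite -[(x `|` y)%O]complK complU (sh_compl fH) (sh_meet fH) !(sh_compl fH).
apply/seteqP; split=> [t [Vt nt]|t [] ft].
- by apply: contrapT => /not_orP[nx ny]; apply: nt; split; split.
- by split; [exact: set_hom_sub ft|move=> [[_]]].
- by split; [exact: set_hom_sub ft|move=> [_ [_]]].
Qed.

Lemma set_hom_algebra : set_algebra V (range f).
Proof.
split.
- by move=> _ [x _ <-]; exact: set_hom_sub.
- by exists \bot%O => //; exact: sh_bot fH.
- by exists \top%O => //; exact: sh_top fH.
- by move=> _ _ [x _ <-] [y _ <-]; exists (x `|` y)%O => //; exact: set_hom_join.
- by move=> _ _ [x _ <-] [y _ <-]; exists (x `&` y)%O => //; exact: sh_meet fH _ _.
- by move=> _ [x _ <-]; exists (~` x)%O => //; exact: sh_compl fH _.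
- by move=> i _ [x _ <-]; exists (cyl i x) => //; exact: sh_cyl fH _ _.
- by move=> i j; exists (diag A i j) => //; exact: sh_diag fH _ _.
Qed.

Lemma set_hom_iso : injective f -> set_iso V (range f) f.
Proof.
move=> f_inj; case: (fH) => *; split=> //; exact: set_hom_join.
Qed.

Lemma set_hom_eq0_inj : (forall x, f x = set0 -> x = \bot%O) -> injective f.
Proof.
move=> f0.
have le_xy x y : f x = f y -> (x <= y)%O.
  move=> fxy; rewrite -[y]complK -disj_leC; apply/eqP/f0.
  by rewrite (sh_meet fH) (sh_compl fH) fxy; apply/seteqP; split=> // t [? []].
by move=> x y fxy; apply/le_anti; rewrite !le_xy.
Qed.

(** The kernel of [f] is a congruence that separates [a] from the bottom, so simplicity makes it the
    identity. *)
Lemma set_hom_simple_inj a : simple_alg A -> f a !=set0 -> injective f.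
Proof.
move=> [_ A_simple] [t fat].
have [||//] := A_simple (fun x y => f x = f y).
- split=> //.
  + by move=> x y z -> ->.
  + by move=> x x' y y' e1 e2; rewrite !set_hom_join e1 e2.
  + by move=> x x' y y' e1 e2; rewrite !(sh_meet fH) e1 e2.
  + by move=> x x' e; rewrite !(sh_compl fH) e.
  + by move=> i x x' e; rewrite !(sh_cyl fH) e.
- by move=> E x y /E.
- by move=> /(_ a \bot%O); rewrite (sh_bot fH) => e; move: fat; rewrite e.
Qed.

End SetHom.

(** * Single models and disjoint unions *)

Section Assembly.
Variables (n : nat) (A : cylAlg 'I_n) (L : Type) (S : set L) (X : L -> set A).
Hypothesis n_gt1 : (1 < n)%N.

Definition omitting_representation (a : A) (U : set nat) (f : A -> set ('I_n -> nat)) : Prop :=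
  [/\ set_hom (power U) f, f a !=set0 &
    forall i, S i -> forall t, exists2 x, X i x & ~ f x t].

Lemma omitted_Cs a U f : omitting_representation a U f -> simple_alg A ->
  omitted (@Cs n) S X.
Proof.
move=> [fH fa fX] A_simple; exists nat, (power U), (range f), f; split.
- by split; [exact: set_hom_algebra|exists U].
- exact/set_hom_iso/(set_hom_simple_inj fH A_simple fa).
- move=> i Si; apply/seteqP; split=> // t tX.
  by have [x Xx []] := fX i Si t; exact: tX.
Qed.

(** The models, one for each nonzero element, become disjoint by tagging their points. The copy
    tagged by [x] has a tuple satisfying [x], whence injectivity. *)
Lemma omitted_Gs : (forall a, a <> \bot%O -> exists U f, omitting_representation a U f) ->
  omitted (@Gs n) S X.
Proof.
move=> H.
pose J := {a : A | a <> \bot%O}.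
have [U UP] : {U : J -> set nat & forall j, exists f, omitting_representation (sval j) (U j) f}.
  apply: (@choice _ _ (fun (j : J) U => exists f, omitting_representation (sval j) U f)).
  by move=> [a a0]; exact: H.
have {UP}[f fP] := choice UP.
have fH j : set_hom (power (U j)) (f j) by case: (fP j).
pose i0 : 'I_n := Ordinal (ltnW n_gt1).
pose UU j : set (J * nat) := [set w | w.1 = j /\ U j w.2].
pose F x : set ('I_n -> J * nat) :=
  [set t | exists j, (forall k, (t k).1 = j) /\ f j x (fun k => (t k).2)].
pose V : set ('I_n -> J * nat) := \bigcup_j power (UU j).
have FE x t j : (forall k, (t k).1 = j) -> F x t <-> f j x (fun k => (t k).2).
  move=> tj; split=> [[j' [tj' ft]]|ft]; last by exists j.
  by rewrite -(tj i0) (tj' i0).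
have VE t : V t <-> exists j, (forall k, (t k).1 = j) /\ power (U j) (fun k => (t k).2).
  split=> [[j _ tU]|[j [tj tU]]]; first by exists j; split=> k; case: (tU k).
  by exists j.
have FH : set_hom V F.
  split.
  - by apply/seteqP; split=> // t [j [_]]; rewrite (sh_bot (fH j)).
  - apply/seteqP; split=> [t [j [tj ft]]|t /VE[j [tj tU]]].
      by apply/VE; exists j; rewrite -(sh_top (fH j)).
    by exists j; rewrite (sh_top (fH j)).
  - move=> x y; apply/seteqP; split=> [t [j [tj]]|t [[j [tj fx]] /(FE _ _ _ tj) fy]].
      by rewrite (sh_meet (fH j)) => -[fx fy]; split; exists j.
    by exists j; rewrite (sh_meet (fH j)).
  - move=> x; apply/seteqP; split=> [t [j [tj]]|t [/VE[j [tj tU]] nt]].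
      rewrite (sh_compl (fH j)) => -[tU nt]; split; first by apply/VE; exists j.
      by move=> /(FE _ _ _ tj).
    exists j; split=> //; rewrite (sh_compl (fH j)); split=> // ft.
    by apply: nt; exists j.
  - move=> i x; apply/seteqP; split=> [t [j [tj]]|t [/VE[j [tj tU]] [u [j' [uj' fu]] ut]]].
      rewrite (sh_cyl (fH j)) => -[tU [u fu ut]]; split; first by apply/VE; exists j.
      exists (fun k => (j, u k)); first by exists j.
      by move=> k ki; rewrite /= (ut k ki) -(tj k); case: (t k).
    exists j; split=> //; rewrite (sh_cyl (fH j)); split=> //.
    exists (fun k => (u k).2); last by move=> k ki; rewrite ut.
    suff <- : j' = j by [].
    (* A coordinate other than [i] is untouched by the cylindrification and determines the copy; it
       exists because the dimension exceeds one. *)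
    have [k ki] : exists k, k <> i.
      have [i_i0|ii0] := eqVneq i i0; last by exists i0; exact/nesym/eqP.
      by exists (Ordinal n_gt1); rewrite i_i0 => /(congr1 (@nat_of_ord n)).
    by rewrite -(uj' k) -(tj k) ut.
  - move=> i j; apply/seteqP; split=> [t [k [tk]]|t [/VE[k [tk tU]] tij]].
      rewrite (sh_diag (fH k)) => -[tU tij]; split; first by apply/VE; exists k.
      by move: tij (tk i) (tk j); case: (t i) (t j) => [? ?] [? ?] /= -> -> ->.
    by exists k; split=> //; rewrite (sh_diag (fH k)); split=> //; rewrite tij.
exists (J * nat)%type, V, (range F), F; split.
- split; first exact: set_hom_algebra.
  exists J, UU; split=> // [j|j j' _ _ [w [[<- _] [<- _]]]//].
  have [_ [t ft] _] := fP j; exists (j, t i0); split=> //=.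
  by have := set_hom_sub (fH j) ft; apply.
- apply: set_hom_iso => //; apply: set_hom_eq0_inj FH _ => x Fx; apply: contrapT => x0.
  have [_ [t ft] _] := fP (exist _ x x0).
  suff : F x (fun k => (exist _ x x0, t k)) by rewrite Fx.
  by exists (exist _ x x0).
- move=> i Si; apply/seteqP; split=> // t tX.
  have [_ _ /(_ i Si (fun k => (t k).2))[x Xx nf]] := fP (t i0).1.
  have [j [tj ft]] := tX x Xx.
  by apply: nf; rewrite tj.
Qed.

End Assembly.

(** * Omitting types *)

Section Omitting.
Variables (n : nat) (A : cylAlg 'I_n) (B : cylAlg nat) (h : A -> B).
Hypothesis hE : neat_embedding h.
Hypothesis Acount : countable [set: A].
Variables (L : Type) (X : L -> set A).

Lemma generic_omitting (S : set L) :
  generic_for (@ext B) S (conditions h) -> (forall i, S i -> nonprincipal_type (X i)) ->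
  forall a, a <> \bot%O -> exists U f, omitting_representation S X a U f.
Proof.
move=> gen Xinf a a0; have [E dE EP] := model_tasks hE Acount.
pose D i k : set B := if unpickle k is Some s then omit h (X i) (s : {ffun 'I_n -> nat}) else setT.
have [|v [vD /EP[v_decide v_henkin] vX]] := gen E D dE _ _ (initial_condition hE a0).
  move=> i Si k; rewrite /D; case: (unpickle k) => [s|]; first exact/dense_omit/Xinf.
  exact/dense_openT/ext_refl.
exists (reps n v), (model h v); split.
- exact: (model_set_hom hE vD v_decide v_henkin).
- apply: (model_nonempty vD (s := @nat_of_ord n)); exists 0%N.
  by case: vD => ->.
- move=> i Si t; have := vX i Si (pickle ([ffun j => t j] : {ffun 'I_n -> nat})).
  rewrite /D pickleK => -[j [x Xx vx]]; exists x => // -[_].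
  apply/(holds_compl hE vD v_decide); exists j.
  move: vx; rewrite (_ : [ffun j => t j] = t :> ('I_n -> nat)) //.
  by apply/funext => m; rewrite ffunE.
Qed.

Definition separated (s s' : 'I_n -> nat) (p q : B) : Prop :=
  (exists x, (p <= sb h s x)%O /\ (q <= sb h s' (~` x))%O) \/ forall x, decide h s x p.

(** If [p] leaves some [x] undecided at [s], both sides are consistent with [p], which then takes
    the side opposite to one that [q] allows at [s']. *)
Lemma dense_separated s s' p q : conditions h p -> conditions h q ->
  exists p' q', [/\ conditions h p', conditions h q', (p' <= p)%O, (q' <= q)%O &
    separated s s' p' q'].
Proof.
move=> Pp Pq.
have [pdec|/existsNP[x npx]] := pselect (forall x, decide h s x p).
  by exists p, q; split=> //; right.
have px : (p `&` sb h s x)%O <> \bot%O.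
  by move=> /eqP; rewrite disj_leC -sb_compl // => px; apply: npx; right.
have pNx : (p `&` sb h s (~` x))%O <> \bot%O.
  by move=> /eqP; rewrite disj_leC -sb_compl // complK => px'; apply: npx; left.
have [qx|nqx] := pselect ((q `&` sb h s' x)%O = \bot%O).
  exists (p `&` sb h s x)%O, q; split=> //; try exact: leIl.
    exact: condition_meet.
  left; exists x; split; first exact: leIr.
  by rewrite sb_compl // -disj_leC qx.
exists (p `&` sb h s (~` x))%O, (q `&` sb h s' x)%O.
split; try exact: leIl; try exact: condition_meet.
by left; exists (~` x)%O; rewrite complK; split; exact: leIr.
Qed.

(* Along the branches of a perfect tree of conditions, two tuples in different
   models have different types unless a condition decides all [sb s x] for one of
   them, and then [condition_not_below] shows that this tuple does not realize a
   non-principal type. So an ultrafilter spoils at most one branch. *)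
Lemma ultrafilter_omitting : card_lt [set: L] [set: nat -> bool] ->
  (forall i, nonprincipal_type (X i)) -> (forall i, ultrafilter (X i)) ->
  forall a, a <> \bot%O -> exists U f, omitting_representation [set: L] X a U f.
Proof.
move=> [_ Lsmall] Xinf Xultra a a0; have [E dE EP] := model_tasks hE Acount.
pose Q t p q := if unpickle t is Some (s, s')
  then separated (s : {ffun 'I_n -> nat}) (s' : {ffun 'I_n -> nat}) p q else True.
have [||v [vP vQ]] := @perfect_tree _ (@ext B) (@ext_refl _) (@ext_trans _)
    (conditions h) E Q dE _ _ _ (initial_condition hE a0).
- move=> t p q Pp Pq; rewrite /Q; case: (unpickle t) => [[s s']|]; first exact: dense_separated.
  by exists p, q; split=> //; exact: ext_refl.
- move=> t p p' q q' p'p q'q; rewrite /Q; case: (unpickle t) => [[s s']|//].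
  move=> [[x [px qx]]|pdec]; [left; exists x|right=> x].
    by split; [exact: le_trans px|exact: le_trans qx].
  by case: (pdec x) => px; [left|right]; exact: le_trans px.
have vD b : descending (@ext B) (conditions h) (sb h (@nat_of_ord n) a) (v b) by case: (vP b).
have v_decide b s x : meets (v b) (decide h s x) by case: (vP b) => _ /EP[].
have v_henkin b s i x : meets (v b) (henkin h s i x) by case: (vP b) => _ /EP[].
pose realized i b t := forall x, X i x -> holds (v b) (sb h t x).
(* The elements true of [t] form a proper filter containing [X i], so by maximality they are exactly
   [X i]. *)
have realized_eq i b t x : realized i b t -> holds (v b) (sb h t x) -> X i x.
  move=> Xt tx; have [_ Xmax] := Xultra i.
  rewrite -(Xmax [set y | holds (v b) (sb h t y)]) //; split=> /=.
  - by exists 0%N; rewrite (sb_top hE) lex1.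
  - by rewrite (sb_bot hE); exact: (holds_bot (vD b)).
  - by move=> y z hy hz; rewrite (sb_meet hE); exact: (holds_meet (vD b)).
  - by move=> y z hy yz; apply: holds_up hy; exact: sb_mono.
have realized_once i b b' t t' : realized i b t -> realized i b' t' -> b = b'.
  move=> Xt Xt'; apply: contrapT => bb'.
  pose tt' := ([ffun k => t k] : {ffun 'I_n -> nat}, [ffun k => t' k] : {ffun 'I_n -> nat}).
  have [j] := vQ b b' (pickle tt') bb'.
  have fE (u : 'I_n -> nat) : ([ffun k => u k] : {ffun 'I_n -> nat}) = u :> ('I_n -> nat).
    by apply/funext => k; rewrite ffunE.
  rewrite /Q pickleK /tt' !fE => -[[x [tx t'x]]|tdec].
    have Xx : X i x by apply: realized_eq Xt _; exists j.
    have /(holds_compl hE (vD b') (v_decide b')) : holds (v b') (sb h t' (~` x)%O) by exists j.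
    by apply; exact: Xt'.
  have Pv : conditions h (v b j) by case: (vD b).
  have [x Xx] := condition_not_below hE t (Xinf i) Pv.
  apply; apply/eqP; rewrite disj_leC -(sb_compl hE) complK.
  case: (tdec x) => // vx.
  have /(holds_compl hE (vD b) (v_decide b)) : holds (v b) (sb h t (~` x)%O) by exists j.
  by case; exact: Xt.
(* Otherwise choosing for each branch an ultrafilter realized on it would embed the branches into
   [L]. *)
have [b bP] : exists b, forall i t, ~ realized i b t.
  apply: contrapT => no; apply: Lsmall.
  have [c cP] : {c : (nat -> bool) -> L & forall b, exists t, realized (c b) b t}.
    apply: (@choice _ _ (fun b i => exists t, realized i b t)) => b.
    apply: contrapT => nb; apply: no; exists b => i t it; apply: nb.
    by exists i, t.
  have c_inj : injective c.
    move=> b b' cbb'; have [t bt] := cP b; have [t' b't'] := cP b'.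
    by move: b't'; rewrite -cbb' => b't'; exact: realized_once bt b't'.
  rewrite -(card_le_eql (inj_card_eq (f := c) (A := setT) _)); last by move=> x y _ _; exact: c_inj.
  exact: subset_card_le.
exists (reps n (v b)), (model h (v b)); split.
- exact: (model_set_hom hE (vD b) (v_decide b) (v_henkin b)).
- apply: (model_nonempty (vD b) (s := @nat_of_ord n)); exists 0%N.
  by case: (vD b) => ->.
- move=> i _ t; apply: contrapT => no; apply: (bP i t) => x Xx.
  by apply: contrapT => nx; apply: no; exists x => // -[].
Qed.

End Omitting.

(** * Atomic algebras *)

Section CompleteRepresentation.
Variables (n : nat) (A : cylAlg 'I_n).

Definition coatoms : set A := [set x | is_atom (~` x)%O].

(** An atom below a lower bound of the coatoms would lie below its own complement. *)
Lemma nonprincipal_coatoms : atomic_alg A -> nonprincipal_type coatoms.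
Proof.
move=> A_atomic; split=> [x _|b bC]; first exact: le0x.
apply: contrapT => b0; have [|a a_atom ab] := A_atomic b.
  by move=> e; apply: b0; rewrite e.
case: (a_atom) => a0 _; apply: a0; apply/le_anti; rewrite le0x andbT.
have /(le_trans ab) : (b <= ~` a)%O by apply: bC; rewrite /coatoms /= complK.
by rewrite -disj_leC meetxx => /eqP ->.
Qed.

Lemma set_iso_atomic (W : Type) (V : set ('I_n -> W)) C (f : A -> set ('I_n -> W)) :
  atomic_alg A -> set_iso V C f -> set_atomic C.
Proof.
move=> A_atomic fI Z; rewrite -(si_range fI) => -[x _ <-] [t fxt].
have [|a [a0 a_min] ax] := A_atomic x.
  by move=> x0; move: fxt; rewrite x0 (si_bot fI).
exists (f a).
  split; first by exists a.
    apply/set0P/eqP => fa0; apply: a0; apply: (si_inj fI).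
    by rewrite fa0 (si_bot fI).
  move=> _ [y _ <-] fya.
  have ya : (y <= a)%O.
    by rewrite leEmeet; apply/eqP/(si_inj fI); rewrite (si_meet fI); exact/setIidPl.
  by have [->|->] := a_min y ya; [left; exact: si_bot fI|right].
by move: ax; rewrite leEmeet => /eqP <-; rewrite (si_meet fI) => u [].
Qed.

(** For each coatom [x], some member of [Y j] is not above the complementary atom, hence lies below
    [x]. A tuple satisfying all of [Y j] would thus satisfy every coatom. *)
Lemma omitted_coatoms_all
    (K K' : forall W : Type, set ('I_n -> W) -> set (set ('I_n -> W)) -> Prop)
    (J : Type) (Y : J -> set A) :
  (forall W V C, K W V C -> set_atomic C -> K' W V C) ->
  atomic_alg A -> (forall j, nonprincipal_type (Y j)) ->
  omitted K [set: unit] (fun=> coatoms) -> omitted K' [set: J] Y.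
Proof.
move=> KK' A_atomic Yinf [W [V [C [f [KC fI fC]]]]].
exists W, V, C, f; split=> //.
  by apply: KK' => //; exact: set_iso_atomic fI.
move=> j _; apply/seteqP; split=> // t tY; rewrite -(fC tt I) => x x_coatom.
have [y Yy nxy] : exists2 y, Y j y & ~ (~` x <= y)%O.
  apply: contrapT => no; case: x_coatom => + _; apply.
  apply/le_anti; rewrite le0x andbT; apply: (Yinf j).2 => y Yy.
  by apply: contrapT => nxy; apply: no; exists y.
have yx : (y <= x)%O.
  rewrite -[x]complK -disj_leC meetC; apply/eqP.
  have [//|e] := x_coatom.2 (~` x `&` y)%O (leIl _ _).
  by case: nxy; rewrite leEmeet e.
by have := tY y Yy; move: yx; rewrite leEmeet => /eqP <-; rewrite (si_meet fI) => -[].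
Qed.

End CompleteRepresentation.

Theorem theorem5p3 (R : realType) (n : nat) (hn : (2 < n)%N)
    (A : cylAlg 'I_n) (hA : ScNrCA A) (hcount : countable [set: A])
    (L : Type) (hL : card_lt [set: L] [set: nat -> bool])
    (X : L -> set A) (hX : forall i, nonprincipal_type (X i)) :
  (* (1) *)
  (NrCA A -> (forall i, ultrafilter (X i)) -> omitted (@Gs n) [set: L] X) /\
  (* (2) *)
  [/\ forall S : set L, lt_p S -> omitted (@Gs n) S X,
      forall S : set L, countable S -> omitted (@Gs n) S X
    & simple_alg A ->
        forall S : set L, lt_covK R S -> omitted (@Cs n) S X] /\
  (* (3) *)
  (atomic_alg A -> countable [set a : A | is_atom a] ->
     forall (J : Type) (Y : J -> set A),
       (forall j, nonprincipal_type (Y j)) ->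
       omitted (@atomic_Gs n) [set: J] Y /\
       (simple_alg A -> omitted (@atomic_Cs n) [set: J] Y)).
Proof.
have [B [h hE]] := ScNr_neat_embedding hA.
have Pcount := @countable_conditions _ _ B h hcount.
have n1 : (1 < n)%N by exact: ltnW.
have simple_nonzero : simple_alg A -> exists a : A, a <> \bot%O.
  move=> [[x [y xy]] _]; apply: contrapT => no; apply: xy.
  have all0 (z : A) : z = \bot%O by apply: contrapT => z0; apply: no; exists z.
  by rewrite (all0 x) (all0 y).
have gs (M : Type) (S : set M) (Z : M -> set A) :
    (forall i, nonprincipal_type (Z i)) ->
    generic_for (@ext B) S (conditions h) -> omitted (@Gs n) S Z.
  by move=> Zinf gen; apply: omitted_Gs => // a a0; apply: (generic_omitting hE).
have cs (M : Type) (S : set M) (Z : M -> set A) : simple_alg A ->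
    (forall i, nonprincipal_type (Z i)) ->
    generic_for (@ext B) S (conditions h) -> omitted (@Cs n) S Z.
  move=> A_simple Zinf gen; have [a a0] := simple_nonzero A_simple.
  have [U [f fP]] := @generic_omitting _ _ _ _ hE hcount _ Z S gen (fun i _ => Zinf i) a a0.
  exact: omitted_Cs fP A_simple.
have countable_generic (M : Type) (S : set M) :
    countable S -> generic_for (@ext B) S (conditions h).
  by apply: generic_countable; exact: ext_refl.
split; last split.
- by move=> _ Xultra; apply: omitted_Gs => // a a0; exact: (ultrafilter_omitting hE).
- split=> [S Sp|S Scount|A_simple S Scov].
  + by apply: gs => //; apply: generic_lt_p => //; [exact: ext_refl|exact: ext_trans].
  + by apply: gs => //; exact: countable_generic.
  (* The empty subfamily is treated as a countable one, since [generic_lt_covK] asks for a member of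
     [S]. *)
  + have [S0|nS] := pselect (S !=set0); last first.
      apply: cs => //; apply: countable_generic.
      by move/set0P/negP/negPn/eqP : nS => ->; exact: countable0.
    by apply: cs => //; apply: (@generic_lt_covK R) => //; exact: ext_refl.
- move=> A_atomic _ J Y Yinf.
  (* Whatever the size of the family [Y], only this one type has to be omitted. *)
  have Cinf := nonprincipal_coatoms A_atomic.
  have unit_generic : generic_for (@ext B) [set: unit] (conditions h).
    by apply: countable_generic; exact: countableP.
  split=> [|A_simple].
    by apply: (omitted_coatoms_all (K := @Gs n)) => //; apply: gs.
  by apply: (omitted_coatoms_all (K := @Cs n)) => //; apply: cs.
Qed.
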